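(* There exists a continuous path $\Phi:[0,1]\to\mathcal{D}_3$ such that, for all $s,t\in[0,1]$, the group $\Phi(t)$ is isomorphic (as an abstract group) to $\Phi(s)$ if and only if $t=s$.
   Context: $\mathcal{D}_3$ is the set of all torsion free discrete subgroups of $\mathrm{Isom}^+(\mathbb{H}^3)$, the group of orientation preserving isometries of hyperbolic $3$-space, equipped with the Chabauty topology. This topology is characterized by its convergent sequences: $\Gamma_i\to\Gamma$ in $\mathcal{D}_3$ if and only if (i) whenever a sequence of elements $\psi_i\in\Gamma_i$ has a subsequence converging to $\psi\in\mathrm{Isom}^+(\mathbb{H}^3)$, then $\psi\in\Gamma$; and (ii) for each $\psi\in\Gamma$ there exist elements $\psi_i\in\Gamma_i$ with $\psi_i\to\psi$ in $\mathrm{Isom}^+(\mathbb{H}^3)$. *)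

(* Defs.v *)
From HB Require Import structures.
From mathcomp Require Import all_boot all_order all_algebra.
From mathcomp Require Import ring lra.
From mathcomp Require Import all_classical all_reals all_analysis.

Set Implicit Arguments.
Unset Strict Implicit.
Unset Printing Implicit Defensive.

Import Order.TTheory GRing.Theory Num.Theory.
Import numFieldNormedType.Exports.

Local Open Scope classical_set_scope.
Local Open Scope ring_scope.

(* Hyperbolic 3-space is the hyperboloid model: the upper sheet of
   <x, x> = -1 in R^{1,3}, with cosh d(x, y) = - <x, y> (curvature -1). *)

Definition lorentz {R : realType} (x y : 'rV[R]_4) : R :=
  - (x 0 ord0 * y 0 ord0)
  + \sum_(i < 3) x 0 (lift ord0 i) * y 0 (lift ord0 i).

Record hyp3 (R : realType) := Hyp3 {
  hyp3_val :> 'rV[R]_4;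
  hyp3P : (lorentz hyp3_val hyp3_val == -1) && (0 < hyp3_val 0 ord0)
}.
Arguments Hyp3 {R}.

HB.instance Definition _ (R : realType) := [isSub for @hyp3_val R].
HB.instance Definition _ (R : realType) := [Choice of hyp3 R by <:].

Definition acosh {R : realType} (u : R) : R := ln (u + Num.sqrt (u ^+ 2 - 1)).

Definition hdist {R : realType} (x y : hyp3 R) : R := acosh (- lorentz x y).

Section HyperbolicMetric.
Variable R : realType.
Implicit Types (u v w : R) (x y z : hyp3 R).

Let i1 : 'I_4 := lift ord0 0.
Let i2 : 'I_4 := lift ord0 1.
Let i3 : 'I_4 := lift ord0 2.

Let lorentzE (a b : 'rV[R]_4) : lorentz a b =
  - (a 0 ord0 * b 0 ord0) + a 0 i1 * b 0 i1 + a 0 i2 * b 0 i2 + a 0 i3 * b 0 i3.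
Proof.
rewrite /lorentz !big_ord_recr big_ord0 /= add0r !addrA.
by do ![congr (_ + _)]; congr (_ * _); congr (_ _ _); exact/val_inj.
Qed.

Let hypE x : 0 < x 0 ord0 /\
  x 0 ord0 ^+ 2 = 1 + x 0 i1 ^+ 2 + x 0 i2 ^+ 2 + x 0 i3 ^+ 2.
Proof.
have /andP[/eqP h x0] := hyp3P x; split => //.
by move: h; rewrite lorentzE => h; lra.
Qed.

Let cauchy3 (a b c p q r : R) : (a * p + b * q + c * r) ^+ 2 <=
  (a ^+ 2 + b ^+ 2 + c ^+ 2) * (p ^+ 2 + q ^+ 2 + r ^+ 2).
Proof.
rewrite -subr_ge0.
rewrite (_ : _ - _ = (a * q - b * p) ^+ 2 + (a * r - c * p) ^+ 2
  + (b * r - c * q) ^+ 2); last by ring.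
by rewrite !addr_ge0 ?sqr_ge0.
Qed.

Lemma lorentzC (a b : 'rV[R]_4) : lorentz a b = lorentz b a.
Proof. by rewrite !lorentzE; ring. Qed.

Let key x y (e := x 0 i1 * y 0 i1 + x 0 i2 * y 0 i2 + x 0 i3 * y 0 i3) :
  (1 + e) ^+ 2 + ((x 0 i1 - y 0 i1) ^+ 2 + (x 0 i2 - y 0 i2) ^+ 2
    + (x 0 i3 - y 0 i3) ^+ 2) <= (x 0 ord0 * y 0 ord0) ^+ 2.
Proof.
have [_ hx] := hypE x; have [_ hy] := hypE y.
rewrite exprMn hx hy /e.
have := cauchy3 (x 0 i1) (x 0 i2) (x 0 i3) (y 0 i1) (y 0 i2) (y 0 i3).
rewrite -subr_ge0 => h; rewrite -subr_ge0; apply: le_trans h _.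
by rewrite le_eqVlt; apply/orP; left; apply/eqP; ring.
Qed.

Lemma lorentz_ge1 x y : 1 <= - lorentz x y.
Proof.
have [x0 _] := hypE x; have [y0 _] := hypE y; have k := key x y.
have xy0 : 0 < x 0 ord0 * y 0 ord0 by exact: mulr_gt0.
rewrite lorentzE.
set e := x 0 i1 * _ + _ + _ in k.
have le : 1 + e <= x 0 ord0 * y 0 ord0.
  have [e0|e0] := leP 0 (1 + e); last by apply: ltW; apply: lt_trans xy0.
  rewrite -(@ler_pXn2r _ 2) ?nnegrE ?(ltW xy0)//.
  by apply: le_trans k; rewrite lerDl !addr_ge0 ?sqr_ge0.
by move: le; rewrite /e; lra.
Qed.

Lemma lorentzxx x : - lorentz x x = 1.
Proof. by have /andP[/eqP -> _] := hyp3P x; rewrite opprK. Qed.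

Lemma lorentz_eq1 x y : - lorentz x y = 1 -> x = y.
Proof.
move=> h; have [x0 hx] := hypE x; have [y0 hy] := hypE y; have k := key x y.
have e : x 0 ord0 * y 0 ord0
    = 1 + (x 0 i1 * y 0 i1 + x 0 i2 * y 0 i2 + x 0 i3 * y 0 i3).
  by move: h; rewrite lorentzE; lra.
move: k; rewrite /= e -subr_ge0 opprD addrA subrr add0r oppr_ge0 => k.
have s1 := sqr_ge0 (x 0 i1 - y 0 i1).
have s2 := sqr_ge0 (x 0 i2 - y 0 i2).
have s3 := sqr_ge0 (x 0 i3 - y 0 i3).
have /eqP : (x 0 i1 - y 0 i1) ^+ 2 = 0 by lra.
have /eqP : (x 0 i2 - y 0 i2) ^+ 2 = 0 by lra.
have /eqP : (x 0 i3 - y 0 i3) ^+ 2 = 0 by lra.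
rewrite !sqrf_eq0 !subr_eq0 => /eqP e3 /eqP e2 /eqP e1.
have e0 : x 0 ord0 = y 0 ord0.
  apply/eqP; rewrite -(@eqrXn2 _ 2) ?(ltW x0) ?(ltW y0)//.
  by rewrite hx hy e1 e2 e3.
apply/val_inj/rowP => i /=.
case: (unliftP ord0 i) => [j ->|->//].
case: j => [[|[|[|//]]] j3].
- by rewrite (_ : lift _ _ = i1)//; exact/val_inj.
- by rewrite (_ : lift _ _ = i2)//; exact/val_inj.
- by rewrite (_ : lift _ _ = i3)//; exact/val_inj.
Qed.

(* The Gram determinant of three points of the hyperboloid is <= 0. *)
Let gram x y z (u := - lorentz x y) (v := - lorentz y z) (w := - lorentz x z) :
  (w - u * v) ^+ 2 <= (u ^+ 2 - 1) * (v ^+ 2 - 1).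
Proof.
have := lorentzxx x; have := lorentzxx y; have := lorentzxx z.
have [x0 hx] := hypE x.
rewrite /u /v /w !lorentzE.
move: (x 0 ord0) (x 0 i1) (x 0 i2) (x 0 i3) x0 hx => a0 a1 a2 a3 a00 ha.
move: (y 0 ord0) (y 0 i1) (y 0 i2) (y 0 i3) => b0 b1 b2 b3.
move: (z 0 ord0) (z 0 i1) (z 0 i2) (z 0 i3) => c0 c1 c2 c3 hc hb ha'.
pose n0 := a1 * (b2 * c3 - b3 * c2) - a2 * (b1 * c3 - b3 * c1)
  + a3 * (b1 * c2 - b2 * c1).
pose n1 := a0 * (b2 * c3 - b3 * c2) - a2 * (b0 * c3 - b3 * c0)
  + a3 * (b0 * c2 - b2 * c0).
pose n2 := a0 * (b1 * c3 - b3 * c1) - a1 * (b0 * c3 - b3 * c0)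
  + a3 * (b0 * c1 - b1 * c0).
pose n3 := a0 * (b1 * c2 - b2 * c1) - a1 * (b0 * c2 - b2 * c0)
  + a2 * (b0 * c1 - b1 * c0).
have orth : n0 * a0 = a1 * n1 + a2 * (- n2) + a3 * n3.
  by rewrite /n0 /n1 /n2 /n3; ring.
have := cauchy3 a1 a2 a3 n1 (- n2) n3; rewrite -orth sqrrN => cs.
have nn : n0 ^+ 2 <= n1 ^+ 2 + n2 ^+ 2 + n3 ^+ 2.
  have a2gt : 0 < a0 ^+ 2 by rewrite exprn_gt0.
  rewrite -(ler_pM2r a2gt) -exprMn; apply: le_trans cs _.
  rewrite [leRHS]mulrC; apply: ler_wpM2r; first by rewrite !addr_ge0 ?sqr_ge0.
  by rewrite ha; lra.
rewrite -subr_ge0.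
set U := - _; set V := - (- (b0 * c0) + _ + _ + _); set W := - (_ + a3 * c3).
have det : (U ^+ 2 - 1) * (V ^+ 2 - 1) - (W - U * V) ^+ 2
    = n1 ^+ 2 + n2 ^+ 2 + n3 ^+ 2 - n0 ^+ 2.
  set A := - _ in ha'; set B := - _ in hb; set C := - _ in hc.
  transitivity (A * B * C + 2 * U * V * W - A * V ^+ 2 - B * W ^+ 2
    - C * U ^+ 2).
    by rewrite ha' hb hc; ring.
  by rewrite /A /B /C /U /V /W /n0 /n1 /n2 /n3; ring.
by rewrite det subr_ge0.
Qed.

Let acosh_arg u : 1 <= u -> 1 <= u + Num.sqrt (u ^+ 2 - 1).
Proof. by move=> h; rewrite -[leLHS]addr0 lerD ?sqrtr_ge0. Qed.

Let acosh_triangle u v w : 1 <= u -> 1 <= v -> 1 <= w ->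
  (w - u * v) ^+ 2 <= (u ^+ 2 - 1) * (v ^+ 2 - 1) ->
  acosh w <= acosh u + acosh v.
Proof.
move=> u1 v1 w1 h; rewrite /acosh.
have u2 : 0 <= u ^+ 2 - 1 by rewrite subr_ge0 exprn_ege1.
have v2 : 0 <= v ^+ 2 - 1 by rewrite subr_ge0 exprn_ege1.
have au := acosh_arg u1; have av := acosh_arg v1; have aw := acosh_arg w1.
have pos t : 1 <= t -> t \is Num.pos by rewrite posrE; apply: lt_le_trans.
rewrite -lnM ?pos//.
rewrite ler_ln ?pos//; last by rewrite mulr_ege1.
set s := Num.sqrt (u ^+ 2 - 1) in au *; set t := Num.sqrt (v ^+ 2 - 1) in av *.
have s0 : 0 <= s by exact: sqrtr_ge0.
have t0 : 0 <= t by exact: sqrtr_ge0.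
have sE : s ^+ 2 = u ^+ 2 - 1 by rewrite sqr_sqrtr.
have tE : t ^+ 2 = v ^+ 2 - 1 by rewrite sqr_sqrtr.
have u0 : 0 <= u by exact: le_trans u1.
have v0 : 0 <= v by exact: le_trans v1.
have wle : w <= u * v + s * t.
  have [d|d] := leP 0 (w - u * v); last first.
    apply: le_trans (_ : u * v <= _); first by rewrite -subr_le0 ltW.
    by rewrite lerDl mulr_ge0.
  rewrite -lerBlDl -(@ler_pXn2r _ 2) ?nnegrE ?mulr_ge0//.
  by rewrite exprMn sE tE.
rewrite (_ : (u + s) * (v + t) = (u * v + s * t) + (u * t + s * v)); last by ring.
apply: lerD => //.
have q0 : 0 <= u * t + s * v by rewrite addr_ge0 ?mulr_ge0.
rewrite -[leRHS](ger0_norm q0) -sqrtr_sqr ler_sqrt ?sqr_ge0//.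
rewrite (_ : (u * t + s * v) ^+ 2 = (u * v + s * t) ^+ 2 - 1); last first.
  rewrite !sqrrD !exprMn sE tE; ring.
by rewrite lerD2r ler_pXn2r ?nnegrE ?addr_ge0 ?mulr_ge0// (le_trans _ w1).
Qed.

Lemma hdistxx x : hdist x x = 0.
Proof. by rewrite /hdist /acosh lorentzxx expr1n subrr sqrtr0 addr0 ln1. Qed.

Lemma hdist_sym x y : hdist x y = hdist y x.
Proof. by rewrite /hdist lorentzC. Qed.

Lemma hdist_positivity x y : hdist x y = 0 -> x = y.
Proof.
rewrite /hdist /acosh => h; apply: lorentz_eq1; have g := lorentz_ge1 x y.
have a := acosh_arg g.
have : expR (ln (- lorentz x y + Num.sqrt ((- lorentz x y) ^+ 2 - 1))) = 1.
  by rewrite h expR0.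
rewrite lnK ?posrE ?(lt_le_trans _ a)// => e; apply/le_anti; rewrite g andbT.
by rewrite -e lerDl sqrtr_ge0.
Qed.

Lemma hdist_triangle y x z : hdist x z <= hdist x y + hdist y z.
Proof. by apply: acosh_triangle; [exact: lorentz_ge1..|exact: gram]. Qed.

End HyperbolicMetric.

HB.instance Definition _ (R : realType) := @isMetric.Build R (hyp3 R)
  hdist (@hdistxx R) (@hdist_positivity R) (@hdist_sym R) (@hdist_triangle R).

(* Sign of the orientation of the (possibly degenerate) geodesic simplex with
   vertices p 0, p 1, p 2, p 3. *)
Definition orientation {R : realType} (p : 'I_4 -> hyp3 R) : R :=
  Num.sg (\det (\matrix_(i < 4) (p i : 'rV[R]_4))).

Record isom (R : realType) := Isom {
  isom_fun :> hyp3 R -> hyp3 R;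
  isom_mdist : forall x y, mdist (isom_fun x) (isom_fun y) = mdist x y;
  isom_surj : forall y, exists x, isom_fun x = y;
  isom_orientation : forall p : 'I_4 -> hyp3 R,
    orientation (isom_fun \o p) = orientation p
}.

HB.instance Definition _ (R : realType) := gen_eqMixin (isom R).
HB.instance Definition _ (R : realType) := gen_choiceMixin (isom R).

Section IsomGroup.
Variable R : realType.
Implicit Types f g h : isom R.

Lemma isomP f g : f =1 g -> f = g.
Proof.
case: f g => [f f1 f2 f3] [g g1 g2 g3] /= /funext fg.
subst g; congr Isom; exact: Prop_irrelevance.
Qed.

Definition isom_one : isom R.
Proof. by refine (@Isom R id _ _ _) => // y; exists y. Defined.

Definition isom_mul f g : isom R.
Proof.
refine (@Isom R (f \o g) _ _ _).
- by move=> x y /=; rewrite !isom_mdist.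
- move=> y; have [z <-] := isom_surj f y; have [x <-] := isom_surj g z.
  by exists x.
- by move=> p; rewrite -compA !isom_orientation.
Defined.

Definition isom_inv_fun f (y : hyp3 R) : hyp3 R := sval (cid (isom_surj f y)).

Lemma isom_invK f : cancel (isom_inv_fun f) f.
Proof. by move=> y; rewrite /isom_inv_fun; case: cid. Qed.

Lemma isom_inj f : injective f.
Proof.
move=> x y fxy; apply: mdist_positivity; rewrite -(isom_mdist f) fxy.
exact: mdistxx.
Qed.

Lemma isom_funK f : cancel f (isom_inv_fun f).
Proof. by move=> x; apply: (@isom_inj f); rewrite isom_invK. Qed.

Definition isom_inv f : isom R.
Proof.
refine (@Isom R (isom_inv_fun f) _ _ _).
- by move=> x y; rewrite -(isom_mdist f) !isom_invK.
- by move=> y; exists (f y); rewrite isom_funK.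
- move=> p; rewrite -(isom_orientation f); congr orientation.
  by apply/funext => i /=; rewrite isom_invK.
Defined.

Lemma isom_mulA : associative isom_mul.
Proof. by move=> f g h; exact: isomP. Qed.

Lemma isom_mul1 : left_id isom_one isom_mul.
Proof. by move=> f; exact: isomP. Qed.

Lemma isom_mulr1 : right_id isom_one isom_mul.
Proof. by move=> f; exact: isomP. Qed.

Lemma isom_mulV : left_inverse isom_one isom_inv isom_mul.
Proof. by move=> f; apply: isomP => x /=; exact: isom_funK. Qed.

Lemma isom_mulrV : right_inverse isom_one isom_inv isom_mul.
Proof. by move=> f; apply: isomP => x /=; exact: isom_invK. Qed.

End IsomGroup.

HB.instance Definition _ (R : realType) := isGroup.Build (isom R)
  (@isom_mulA R) (@isom_mul1 R) (@isom_mulr1 R) (@isom_mulV R) (@isom_mulrV R).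

HB.instance Definition _ (R : realType) := Topological.copy (isom R)
  (@initial_topology (isom R) {compact-open, hyp3 R -> hyp3 R} (@isom_fun R)).

Definition is_subgroup {G : groupType} (H : set G) : Prop :=
  H 1%g /\ forall x y, H x -> H y -> H (x / y)%g.

Definition torsion_free {G : groupType} (H : set G) : Prop :=
  forall x (n : nat), H x -> (0 < n)%N -> (x ^+ n)%g = 1%g -> x = 1%g.

Definition discrete {T : topologicalType} (A : set T) : Prop :=
  A `<=` isolated A.

Definition group_isomorphic {G : groupType} (H K : set G) : Prop :=
  exists f : G -> G, set_bij H K f /\
    forall x y, H x -> H y -> f (x * y)%g = (f x * f y)%g.

Record D3 (R : realType) := MkD3 {
  D3_set :> set (isom R);
  D3_subgroup : is_subgroup D3_set;
  D3_torsion_free : torsion_free D3_set;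
  D3_discrete : discrete D3_set
}.

HB.instance Definition _ (R : realType) := gen_eqMixin (D3 R).
HB.instance Definition _ (R : realType) := gen_choiceMixin (D3 R).

Definition chabauty_cvg {R : realType} (Gamma : nat -> D3 R) (G : D3 R) : Prop :=
  (forall (psi : nat -> isom R) (k : nat -> nat) (g : isom R),
      (forall i, D3_set (Gamma i) (psi i)) -> increasing_seq k ->
      psi \o k @ \oo --> g -> D3_set G g) /\
  (forall g : isom R, D3_set G g -> exists psi : nat -> isom R,
      (forall i, D3_set (Gamma i) (psi i)) /\ psi @ \oo --> g).

(* The Chabauty topology is metrizable, hence it is determined by its
   convergent sequences: its open sets are the sequentially open ones. *)
Definition chabauty_open {R : realType} (U : set (D3 R)) : Prop :=
  forall (Gamma : nat -> D3 R) (G : D3 R),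
    chabauty_cvg Gamma G -> U G -> \forall i \near \oo, U (Gamma i).

Section ChabautyTopology.
Variable R : realType.

Lemma chabauty_openT : chabauty_open [set: D3 R].
Proof. by move=> Gamma G _ _; exact: nearW. Qed.

Lemma chabauty_openI : setI_closed (@chabauty_open R).
Proof.
move=> U V oU oV Gamma G cG [UG VG].
by apply: filterI; [exact: oU cG UG|exact: oV cG VG].
Qed.

Lemma chabauty_open_bigU (I : Type) (f : I -> set (D3 R)) :
  (forall i, chabauty_open (f i)) -> chabauty_open (\bigcup_i f i).
Proof.
move=> of_ Gamma G cG [i _ fiG].
by apply: filterS (of_ i _ _ cG fiG) => n ?; exists i.
Qed.

End ChabautyTopology.

HB.instance Definition _ (R : realType) := isOpenTopological.Build (D3 R)
  (@chabauty_openT R) (@chabauty_openI R) (@chabauty_open_bigU R).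

(* Main.v *)
(* Let G = <X, Y, T | [T, [X, Y]] = 1>, realized in SL_2(Z[i]) with <X, Y> the free
   group of a once-punctured torus, [X, Y] a parabolic fixing infinity and T a long
   translation in an independent direction. It is discrete and torsion free, and its
   k-fold cyclic cover G_k has [X, Y] as a torsion element of order k in its
   abelianization. After conjugation so that infinity lies in the domain of
   discontinuity, every nontrivial element has a lower left entry of modulus at least 1
   and at least that of the diagonal entries.

   Hence conjugates of the G_{p_n} by z -> l_n z + n, for distinct primes p_n and small
   l_n > 0, play ping-pong and generate their free product. As l_n -> 0 the n-th factor
   leaves every compact set of isometries, so that the group depends continuously on
   (l_n) even at l_n = 0, where the factor is dropped. Let l_n(t) > 0 exactly when t
   exceeds the n-th rational number: then p_n-torsion in the abelianization shows that
   different t give non-isomorphic groups. *)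
Require Import Defs.
From HB Require Import structures.
From mathcomp Require Import all_boot all_order all_algebra.
From mathcomp Require Import all_classical all_reals all_analysis.
From mathcomp Require Import ring lra zify.
From mathcomp Require Import complex.

Set Implicit Arguments.
Unset Strict Implicit.
Unset Printing Implicit Defensive.

Import Order.TTheory GRing.Theory Num.Theory.
Import numFieldNormedType.Exports.

Local Open Scope classical_set_scope.
Local Open Scope ring_scope.

Local Notation Re := complex.Re.
Local Notation Im := complex.Im.

(** The torsion has a topological source. The k-fold cover of the once-punctured torus has k
    punctures, whose boundary loops sum to 0 in homology. As T also maps to a generator of Z/k, a
    single torus lies above the one of <T, [X, Y]> and all k punctures are attached to it; the loops
    become homologous, and k times their common class is 0. The geometry is read off one matrix
    entry. Twice the cosh of the displacement of a base point is at least the squared modulus of the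
    lower left entry, and conjugation by z -> l z + n divides this entry by l. With infinity an
    ordinary point, each nontrivial element has its isometric circle and its image disc inside |z|
    <= 2, hence within 2 l <= 1/4 of n after the conjugation. Ping-pong then multiplies lower left
    entries, which gives discreteness, the free product structure and, through bounds independent of
    the l_n, the limits. Equality in G is never defined by a presentation: a normal form shows that
    equal matrices have equal path sums, and homomorphisms can therefore be defined on matrices. *)

Record mat2 (K : Type) := Mat2 { ma : K; mb : K; mc : K; md : K }.

(** * Two-by-two matrices *)

Section Mat2.
Variable K : comNzRingType.
Implicit Types g h k : mat2 K.

Lemma mat2P g h :
  ma g = ma h -> mb g = mb h -> mc g = mc h -> md g = md h -> g = h.
Proof. by case: g h => [????] [????] /= -> -> -> ->. Qed.

Definition mmul g h := Mat2
  (ma g * ma h + mb g * mc h) (ma g * mb h + mb g * md h)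
  (mc g * ma h + md g * mc h) (mc g * mb h + md g * md h).
Definition mone : mat2 K := Mat2 1 0 0 1.
Definition mopp g := Mat2 (- ma g) (- mb g) (- mc g) (- md g).
Definition mdet g := ma g * md g - mb g * mc g.
(* The adjugate, hence the inverse only when the determinant is [1]. *)
Definition minv g := Mat2 (md g) (- mb g) (- mc g) (ma g).

Lemma mmulA : associative mmul.
Proof. by move=> g h k; apply: mat2P => /=; ring. Qed.
Lemma mmul1 : left_id mone mmul.
Proof. by move=> g; apply: mat2P => /=; ring. Qed.
Lemma mmulr1 : right_id mone mmul.
Proof. by move=> g; apply: mat2P => /=; ring. Qed.
Lemma mdetM g h : mdet (mmul g h) = mdet g * mdet h.
Proof. by rewrite /mdet /=; ring. Qed.
Lemma mdet1 : mdet mone = 1.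
Proof. by rewrite /mdet /=; ring. Qed.
Lemma mdetV g : mdet (minv g) = mdet g.
Proof. by rewrite /mdet /=; ring. Qed.
Lemma minvK : involutive minv.
Proof. by move=> g; apply: mat2P => /=; ring. Qed.
Lemma minvM g h : minv (mmul g h) = mmul (minv h) (minv g).
Proof. by apply: mat2P => /=; ring. Qed.
Lemma minv1 : minv mone = mone.
Proof. by apply: mat2P => /=; ring. Qed.
Lemma mmulV g : mdet g = 1 -> mmul (minv g) g = mone.
Proof. by rewrite /mdet => e; apply: mat2P => /=; rewrite -?e; ring. Qed.
Lemma mmulrV g : mdet g = 1 -> mmul g (minv g) = mone.
Proof. by rewrite /mdet => e; apply: mat2P => /=; rewrite -?e; ring. Qed.
Lemma mmulK g h : mdet h = 1 -> mmul (mmul g h) (minv h) = g.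
Proof. by move=> e; rewrite -mmulA mmulrV// mmulr1. Qed.
Lemma mmulKV g h : mdet h = 1 -> mmul (mmul g (minv h)) h = g.
Proof. by move=> e; rewrite -mmulA mmulV// mmulr1. Qed.

Fixpoint mpow g n := if n is n'.+1 then mmul g (mpow g n') else mone.

Lemma mpowS g n : mpow g n.+1 = mmul g (mpow g n). Proof. by []. Qed.
Lemma mpowSr g n : mpow g n.+1 = mmul (mpow g n) g.
Proof.
elim: n => [|n IH]; first by rewrite /= mmulr1 mmul1.
by rewrite mpowS {1}IH mmulA.
Qed.
Lemma mpow_conj g h n : mdet h = 1 ->
  mpow (mmul (mmul h g) (minv h)) n = mmul (mmul h (mpow g n)) (minv h).
Proof.
move=> e; elim: n => [|n IH]; first by rewrite mmulr1 mmulrV.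
by rewrite !mpowS IH !mmulA mmulKV.
Qed.

End Mat2.
Arguments mone {K}.

(** * Modulus of complex numbers *)

Section Cnorm.
Variable R : realType.
Implicit Types z w : R[i].
Import ComplexField.Normc.

Definition cn z : R := normc z.

Lemma cnC z : (cn z)%:C%C = `|z|. Proof. by rewrite normc_def; case: z. Qed.
Lemma cn_ge0 z : 0 <= cn z.
Proof. by rewrite -ler0c cnC. Qed.
Lemma cn0 : cn 0 = 0. Proof. exact: normc0. Qed.
Lemma cn1 : cn 1 = 1. Proof. exact: normc1. Qed.
Lemma cnM z w : cn (z * w) = cn z * cn w. Proof. exact: normcM. Qed.
Lemma cnX z n : cn (z ^+ n) = cn z ^+ n.
Proof. by elim: n => [|n IH]; rewrite ?expr0 ?cn1// !exprS cnM IH. Qed.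
Lemma cnD z w : cn (z + w) <= cn z + cn w. Proof. exact: le_normcD. Qed.
Lemma cnN z : cn (- z) = cn z. Proof. exact: normcN. Qed.
Lemma cnB z w : cn z - cn w <= cn (z + w).
Proof. by have := cnD (z + w) (- w); rewrite addrK cnN lerBlDr. Qed.
Lemma cn_eq0 z : (cn z == 0) = (z == 0).
Proof. by apply/eqP/eqP => [/eq0_normc//|->]; exact: cn0. Qed.
Lemma cn_gt0 z : (0 < cn z) = (z != 0).
Proof. by rewrite lt_neqAle cn_ge0 andbT eq_sym cn_eq0. Qed.
Lemma cn_sqr z : cn z ^+ 2 = Re z ^+ 2 + Im z ^+ 2.
Proof. by case: z => a b; rewrite /cn/= sqr_sqrtr// addr_ge0 ?sqr_ge0. Qed.
Lemma cnr (x : R) : cn x%:C%C = `|x|.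
Proof. by rewrite /cn/= expr0n/= addr0 sqrtr_sqr. Qed.
Lemma cn_int (n : int) : cn n%:~R = `|n%:~R|.
Proof. by rewrite -(rmorph_int (real_complex R)) cnr. Qed.
Lemma cnV z : cn z^-1 = (cn z)^-1. Proof. exact: normcV. Qed.
Lemma ReIm_le z : `|Re z| <= cn z /\ `|Im z| <= cn z.
Proof.
have h x y : `|x : R| <= Num.sqrt (x ^+ 2 + y ^+ 2).
  by rewrite -sqrtr_sqr ler_wsqrtr// lerDl sqr_ge0.
by case: z => x y /=; split; [exact: h|rewrite addrC; exact: h].
Qed.

End Cnorm.

(** * The action of SL_2(C) on hyperbolic space *)

Section Action.
Variable R : realType.
Local Notation C := R[i].
Implicit Types (g h : mat2 C) (x y : 'rV[R]_4).

Let o1 : 'I_4 := @Ordinal 4 1 isT.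
Let o2 : 'I_4 := @Ordinal 4 2 isT.
Let o3 : 'I_4 := @Ordinal 4 3 isT.

Lemma lorentz4 x y : lorentz x y =
  - (x 0 ord0 * y 0 ord0) + x 0 o1 * y 0 o1 + x 0 o2 * y 0 o2 + x 0 o3 * y 0 o3.
Proof.
rewrite /lorentz !big_ord_recr big_ord0 /= add0r !addrA.
by do ![congr (_ + _)]; congr (_ * _); congr (_ _ _); exact/val_inj.
Qed.

Lemma rV4P x y : x 0 ord0 = y 0 ord0 -> x 0 o1 = y 0 o1 -> x 0 o2 = y 0 o2 ->
  x 0 o3 = y 0 o3 -> x = y.
Proof.
move=> h0 h1 h2 h3; apply/rowP => -[[|[|[|[|//]]]] i4].
- by rewrite (_ : Ordinal _ = ord0)//; exact/val_inj.
- by rewrite (_ : Ordinal _ = o1)//; exact/val_inj.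
- by rewrite (_ : Ordinal _ = o2)//; exact/val_inj.
- by rewrite (_ : Ordinal _ = o3)//; exact/val_inj.
Qed.

(** Minkowski space as the Hermitian matrices: the quadratic form becomes minus the determinant, and
    SL_2(C) acts by congruence. *)
Definition herm x : mat2 C := Mat2 (x 0 ord0 + x 0 o3)%:C%C
  (x 0 o1 +i* x 0 o2)%C (x 0 o1 -i* x 0 o2)%C (x 0 ord0 - x 0 o3)%:C%C.

Definition unherm (X : mat2 C) : 'rV[R]_4 := \row_i nth 0
  [:: (Re (ma X) + Re (md X)) / 2; Re (mb X); Im (mb X);
      (Re (ma X) - Re (md X)) / 2] i.

Definition mstar g : mat2 C := Mat2 (ma g)^*%C (mc g)^*%C (mb g)^*%C (md g)^*%C.

Definition act g x := unherm (mmul (mmul g (herm x)) (mstar g)).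

Lemma mstarM g h : mstar (mmul g h) = mmul (mstar h) (mstar g).
Proof. by apply: mat2P; rewrite /= !rmorphD !rmorphM; ring. Qed.

Lemma mstarK : involutive mstar.
Proof. by move=> g; apply: mat2P; rewrite /= conjcK. Qed.

Lemma mstar_herm x : mstar (herm x) = herm x.
Proof. by apply: mat2P; rewrite /= ?oppr0 ?opprK. Qed.

Lemma unhermK X : mstar X = X -> herm (unherm X) = X.
Proof.
case: X => -[a a'] [b b'] [c c'] [d d'] /= [ha hc hc' hb hb' hd].
apply: mat2P => /=; rewrite /herm /unherm !mxE /=; apply/eqP; rewrite eq_complex /=;
  apply/andP; split; apply/eqP; lra.
Qed.

Lemma hermK x : unherm (herm x) = x.
Proof. by apply: rV4P; rewrite !mxE /=; lra. Qed.

Lemma herm_act g x : herm (act g x) = mmul (mmul g (herm x)) (mstar g).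
Proof.
by apply: unhermK; rewrite !mstarM mstarK mstar_herm mmulA.
Qed.

Lemma actM g h x : act (mmul g h) x = act g (act h x).
Proof. by rewrite {1 2}/act herm_act mstarM !mmulA. Qed.

Lemma act1 x : act mone x = x.
Proof.
rewrite /act mmul1 (_ : mstar mone = mone) ?mmulr1 ?hermK//.
by apply: mat2P; apply/eqP; rewrite eq_complex /= ?oppr0 !eqxx.
Qed.

Lemma actN g x : act (mopp g) x = act g x.
Proof.
congr unherm; apply: mat2P => /=; rewrite !rmorphN; ring.
Qed.

Lemma act_linear g : linear (act g).
Proof.
move=> k x y; case: g => -[a a'] [b b'] [c c'] [d d'].
by apply: rV4P; rewrite !mxE /= !mxE; ring.
Qed.

HB.instance Definition _ g := GRing.isLinear.Build R _ _ _ (act g) (act_linear g).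

Lemma mdet_herm x : mdet (herm x) = (- lorentz x x)%:C%C.
Proof.
apply/eqP; rewrite lorentz4 eq_complex /mdet /=; apply/andP; split; apply/eqP; ring.
Qed.

Lemma mdet_star g : mdet (mstar g) = (mdet g)^*%C.
Proof. by rewrite /mdet /= rmorphB !rmorphM /=; ring. Qed.

Lemma lorentz_act_diag g x : mdet g = 1 -> lorentz (act g x) (act g x) = lorentz x x.
Proof.
move=> g1; apply: oppr_inj; apply: (@complexI R).
by rewrite -!mdet_herm herm_act !mdetM mdet_star g1 conjc1 mul1r mulr1.
Qed.

Lemma lorentzD x y :
  lorentz (x + y) (x + y) = lorentz x x + lorentz y y + 2 * lorentz x y.
Proof. by rewrite !lorentz4 !mxE; ring. Qed.

Lemma lorentz_act g x y : mdet g = 1 -> lorentz (act g x) (act g y) = lorentz x y.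
Proof.
move=> g1; have := lorentz_act_diag (x + y) g1.
rewrite linearD !lorentzD !lorentz_act_diag//= => /addrI h.
have : (2 : R) != 0 by rewrite pnatr_eq0.
by move/mulfI; apply.
Qed.

Lemma hyp3_diag (x : hyp3 R) : 0 < x 0 ord0 /\
  x 0 ord0 ^+ 2 = 1 + x 0 o1 ^+ 2 + x 0 o2 ^+ 2 + x 0 o3 ^+ 2.
Proof.
have /andP[/eqP h x0] := hyp3P x; split => //.
by move: h; rewrite lorentz4 => h; lra.
Qed.

(* [pos] bounds the value of the positive form [herm x] on a row of [g]. *)
Lemma act_pos g (x : hyp3 R) : mdet g = 1 -> 0 < act g x 0 ord0.
Proof.
move=> g1; have [x0 hx] := hyp3_diag x.
have pos (a a' b b' : R) : 0 <= (a ^+ 2 + a' ^+ 2) * (x 0 ord0 + x 0 o3)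
    + (b ^+ 2 + b' ^+ 2) * (x 0 ord0 - x 0 o3)
    + 2 * ((a * b + a' * b') * x 0 o1 + (a * b' - a' * b) * x 0 o2).
  have p0 : 0 < x 0 ord0 + x 0 o3 by nra.
  rewrite -(pmulr_rge0 _ p0) [X in 0 <= X](_ : _ =
    (a * (x 0 ord0 + x 0 o3) + b * x 0 o1 + b' * x 0 o2) ^+ 2
    + (a' * (x 0 ord0 + x 0 o3) + b' * x 0 o1 - b * x 0 o2) ^+ 2
    + (b ^+ 2 + b' ^+ 2) * (x 0 ord0 ^+ 2 - x 0 o1 ^+ 2 - x 0 o2 ^+ 2 - x 0 o3 ^+ 2));
    last by ring.
  rewrite (_ : _ - x 0 o3 ^+ 2 = 1); last by rewrite hx; ring.
  by rewrite mulr1 !addr_ge0 ?sqr_ge0.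
have nz : act g x 0 ord0 != 0.
  apply/eqP => z; have := lorentz_act_diag x g1.
  have /andP[/eqP -> _] := hyp3P x; rewrite lorentz4 z => h.
  by have := sqr_ge0 (act g x 0 o1); have := sqr_ge0 (act g x 0 o2);
    have := sqr_ge0 (act g x 0 o3); lra.
rewrite lt_neqAle eq_sym nz /=; case: g {g1 nz} => -[a a'] [b b'] [c c'] [d d'].
have := pos a a' b b'; have := pos c c' d d'.
by rewrite !mxE /=; lra.
Qed.

Definition act_mx g : 'M[R]_4 := lin1_mx (act g).

Lemma mul_act_mx g x : x *m act_mx g = act g x.
Proof. exact: mul_rV_lin1. Qed.

Lemma act_mxM g h : act_mx (mmul g h) = act_mx h *m act_mx g.
Proof.
apply/row_matrixP => i; rewrite !rowE mulmxA !mul_act_mx.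
exact: actM.
Qed.

Lemma act_mx1 : act_mx mone = 1%:M.
Proof. by apply/row_matrixP => i; rewrite !rowE mul_act_mx act1 mulmx1. Qed.

(* Up to sign, every element of determinant 1 is the square of another one,
   namely [(g + 1) / sqrt (tr g + 2)]. *)
Lemma mat2_sqrt g : mdet g = 1 -> ma g + md g + 2 != 0 ->
  exists2 h, mdet h = 1 & mmul h h = g.
Proof.
move=> g1 t; pose s := sqrtc (ma g + md g + 2).
have s2 : s ^+ 2 = ma g + md g + 2 by exact: sqr_sqrtc.
have s0 : s != 0 by rewrite sqrtc_eq0.
have sV : s^-1 * s = 1 by rewrite mulVf.
have e : s^-1 * s^-1 * (ma g + md g + 2) = 1 by rewrite -s2 expr2 mulrACA sV mulr1.
exists (Mat2 ((ma g + 1) / s) (mb g / s) (mc g / s) ((md g + 1) / s)).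
  move: g1; rewrite /mdet /= => g1; apply: (etrans _ e).
  by rewrite (_ : ma g + _ + 2 = ma g * md g - mb g * mc g + ma g + md g + 1);
    [ring|rewrite g1; ring].
move: g1; rewrite /mdet => g1; apply: mat2P => /=.
- apply: (etrans _ (mul1r _)); rewrite -[X in _ = X * _]e.
  transitivity (s^-1 * s^-1 * (ma g ^+ 2 + 2 * ma g + (ma g * md g - (ma g * md g - mb g * mc g)) + 1)); first by ring.
  by rewrite g1; ring.
- by apply: (etrans _ (mul1r _)); rewrite -[X in _ = X * _]e; ring.
- by apply: (etrans _ (mul1r _)); rewrite -[X in _ = X * _]e; ring.
- apply: (etrans _ (mul1r _)); rewrite -[X in _ = X * _]e.
  transitivity (s^-1 * s^-1 * (md g ^+ 2 + 2 * md g + (ma g * md g - (ma g * md g - mb g * mc g)) + 1)); first by ring.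
  by rewrite g1; ring.
Qed.

Lemma det_act_mx_neq0 g : mdet g = 1 -> \det (act_mx g) != 0.
Proof.
move=> g1; have := mmulrV g1 => /(congr1 act_mx); rewrite act_mxM act_mx1.
move/(congr1 determinant); rewrite det_mulmx det1 => e.
by apply/eqP => z; move: e; rewrite z mulr0 => /esym/eqP; rewrite oner_eq0.
Qed.

(** Either [g] or its negative is a square, both act alike, and the action of a square has a square
    as determinant. This replaces an appeal to the connectedness of SL_2(C). *)
Lemma det_act_mx g : mdet g = 1 -> 0 < \det (act_mx g).
Proof.
have sq h : mdet h = 1 -> 0 < \det (act_mx (mmul h h)).
  move=> h1; rewrite act_mxM det_mulmx -expr2 lt_neqAle sqr_ge0 andbT.
  by rewrite eq_sym sqrf_eq0 det_act_mx_neq0.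
move=> g1; have [t|t] := eqVneq (ma g + md g + 2) 0; last first.
  by have [h h1 <-] := mat2_sqrt g1 t; exact: sq.
rewrite (_ : act_mx g = act_mx (mopp g)); last first.
  by apply/row_matrixP => i; rewrite !rowE !mul_act_mx actN.
have g1' : mdet (mopp g) = 1 by rewrite -g1 /mdet /=; ring.
have t' : ma (mopp g) + md (mopp g) + 2 != 0.
  rewrite (_ : _ + 2 = 4 - (ma g + md g + 2)); last by rewrite /=; ring.
  by rewrite t subr0 pnatr_eq0.
by have [h h1 <-] := mat2_sqrt g1' t'; exact: sq.
Qed.

End Action.

Section ToIsom.
Variable R : realType.
Local Notation C := R[i].
Implicit Types (g h : mat2 C) (x y : hyp3 R).

Lemma hact_subproof g (g1 : mdet g = 1) x :
  (lorentz (act g x) (act g x) == -1) && (0 < act g x 0 ord0).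
Proof.
rewrite lorentz_act_diag// act_pos// andbT.
by case/andP: (hyp3P x).
Qed.

Definition hact g (g1 : mdet g = 1) x : hyp3 R := Hyp3 (act g x) (hact_subproof g1 x).

Lemma hact_mdist g (g1 : mdet g = 1) x y : mdist (hact g1 x) (hact g1 y) = mdist x y.
Proof. by rewrite /mdist /= /hdist /= lorentz_act. Qed.

Lemma hact_surj g (g1 : mdet g = 1) y : exists x, hact g1 x = y.
Proof.
have g1' : mdet (minv g) = 1 by rewrite mdetV.
exists (hact g1' y); apply: val_inj => /=.
by rewrite -actM mmulrV// act1.
Qed.

Lemma hact_orientation g (g1 : mdet g = 1) (p : 'I_4 -> hyp3 R) :
  orientation (hact g1 \o p) = orientation p.
Proof.
rewrite /orientation (_ : \matrix_i _ = (\matrix_i (p i : 'rV[R]_4)) *m act_mx g).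
  by rewrite det_mulmx sgrM [X in _ * X]gtr0_sg ?mulr1// det_act_mx.
by apply/row_matrixP => i; rewrite row_mul !rowK mul_act_mx.
Qed.

(* The isometry of a matrix of determinant 1; the identity otherwise. *)
Definition to_isom g : isom R :=
  if eqVneq (mdet g) 1 is EqNotNeq g1 then
    Isom (hact_mdist g1) (hact_surj g1) (hact_orientation g1)
  else isom_one R.

Lemma to_isomE g x : mdet g = 1 -> to_isom g x = act g x :> 'rV[R]_4.
Proof. by rewrite /to_isom; case: eqVneq => // /eqP. Qed.

Lemma to_isom1 : to_isom mone = 1%g.
Proof.
by apply: isomP => x; apply: val_inj; rewrite /= to_isomE ?mdet1// act1.
Qed.

Lemma to_isomM g h : mdet g = 1 -> mdet h = 1 ->
  to_isom (mmul g h) = (to_isom g * to_isom h)%g.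
Proof.
move=> g1 h1; apply: isomP => x; apply: val_inj => /=.
by rewrite !to_isomE ?mdetM ?g1 ?h1 ?mulr1// actM.
Qed.

Lemma to_isomV g : mdet g = 1 -> to_isom (minv g) = (to_isom g)^-1%g.
Proof.
move=> g1; apply: (@mulgI _ (to_isom g)).
by rewrite -to_isomM ?mdetV// mmulrV// to_isom1 mulgV.
Qed.

Lemma to_isomX g n : mdet g = 1 -> to_isom (mpow g n) = (to_isom g ^+ n)%g.
Proof.
move=> g1; have gn m : mdet (mpow g m) = 1.
  by elim: m => [|m IH]; rewrite ?mdet1// mdetM g1 IH mulr1.
by elim: n => [|n IH]; rewrite ?to_isom1 ?expg0// mpowS to_isomM// IH expgS.
Qed.

End ToIsom.

(** * Convergence of isometries *)

Section IsomTopology.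
Variable R : realType.
Implicit Types (f g : isom R) (psi : nat -> isom R) (x y : hyp3 R).

Lemma cvg_mdistP (u : nat -> hyp3 R) x :
  u @ \oo --> x <-> forall e, 0 < e -> \forall i \near \oo, mdist x (u i) < e.
Proof.
split=> [/cvg_ballP h e e0|h]; first by have := h e e0; rewrite ballEmdist.
by apply/cvg_ballP => e e0; rewrite ballEmdist; exact: h.
Qed.

Lemma nbhs_isom_eval g x e : 0 < e -> nbhs g [set f | mdist (g x) (f x) < e].
Proof.
move=> e0; pose O := [set y | mdist (g x) y < e]°.
have gO : O (g x) by rewrite /O -ballEmdist; exact: nbhsx_ballx.
have oO : open O by exact: open_interior.
have nO : nbhs g [set f | isom_fun f @` [set x] `<=` O].
  apply: open_nbhs_nbhs; split; last by move=> _ [_ -> <-].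
  exists [set h : hyp3 R -> hyp3 R | h @` [set x] `<=` O] => //.
  have := @compact_open_open (hyp3 R) (hyp3 R) [set x] O (@compact_set1 _ x) oO.
  by [].
apply: filterS nO => f /= h.
by have : O (f x) by [apply: h; exists x]; move=> /interior_subset.
Qed.

Lemma cvg_isom_eval psi g x : psi @ \oo --> g -> (fun i => psi i x) @ \oo --> g x.
Proof.
by move=> cpsi; apply/cvg_mdistP => e e0; exact: (cpsi _ (nbhs_isom_eval g x e0)).
Qed.

(** Isometries are equicontinuous, so pointwise convergence is uniform near each point, hence on
    compact sets. *)
Lemma eval_cvg_isom psi g :
  (forall x, (fun i => psi i x) @ \oo --> g x) -> psi @ \oo --> g.
Proof.
move=> h A [B [[W oW <-] Wg] sB]; apply: (filterS sB).
suff : (fun i => isom_fun (psi i) : {compact-open, hyp3 R -> hyp3 R}) @ \oo -->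
    (isom_fun g : {compact-open, hyp3 R -> hyp3 R}).
  by apply; apply: open_nbhs_nbhs.
apply/compact_open_cvgP => K U /compact_near_coveringP cK oU gKU.
have H : \forall i \near \oo, K `<=` (fun x => U (psi i x)).
  apply: (cK nat \oo (fun i x => U (psi i x))) => x Kx.
  have /nbhs_ballP[e /= e0 eU] : nbhs (g x) U.
    by apply: open_nbhs_nbhs; split => //; apply: gKU; exists x.
  have e20 : 0 < e / 2 by rewrite divr_gt0.
  have /cvg_mdistP/(_ _ e20) hx := h x.
  exists (ball x (e / 2), [set i | mdist (g x) (psi i x) < e / 2]).
    by split => //; exact: nbhsx_ballx.
  move=> [y i] /=; rewrite ballEmdist /= => -[xy gi]; apply: eU.
  rewrite ballEmdist /= (le_lt_trans (metric_triangle _ (psi i x) _))//.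
  by rewrite isom_mdist [e]splitr ltrD.
by apply: filterS H => i hi _ [x Kx <-]; exact: hi.
Qed.

End IsomTopology.

Section MatrixConvergence.
Variable R : realType.
Local Notation C := R[i].
Implicit Types (u v : nat -> C) (M N : nat -> mat2 C).

Definition ccvg u (l : C) :=
  (fun i => Re (u i)) @ \oo --> Re l /\ (fun i => Im (u i)) @ \oo --> Im l.

Lemma ccvg_cst (l : C) : ccvg (fun=> l) l.
Proof. by split; exact: cvg_cst. Qed.

Lemma ccvgD u v k l : ccvg u k -> ccvg v l -> ccvg (fun i => u i + v i) (k + l).
Proof.
move=> [u1 u2] [v1 v2]; split.
  rewrite (_ : Re (k + l) = Re k + Re l); last by case: k l {u1 u2 v1 v2} => ?? [].
  rewrite (_ : (fun i => _) = (fun i => Re (u i) + Re (v i))); first exact: cvgD.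
  by apply/funext => i; case: (u i) (v i) => ?? [].
rewrite (_ : Im (k + l) = Im k + Im l); last by case: k l {u1 u2 v1 v2} => ?? [].
rewrite (_ : (fun i => _) = (fun i => Im (u i) + Im (v i))); first exact: cvgD.
by apply/funext => i; case: (u i) (v i) => ?? [].
Qed.

Lemma ccvgM u v k l : ccvg u k -> ccvg v l -> ccvg (fun i => u i * v i) (k * l).
Proof.
move=> [u1 u2] [v1 v2]; split.
  rewrite (_ : Re (k * l) = Re k * Re l - Im k * Im l); last by case: k l {u1 u2 v1 v2} => ?? [].
  rewrite (_ : (fun i => _) = (fun i => Re (u i) * Re (v i) - Im (u i) * Im (v i))).
    by apply: cvgB; exact: cvgM.
  by apply/funext => i; case: (u i) (v i) => ?? [].
rewrite (_ : Im (k * l) = Re k * Im l + Im k * Re l); last by case: k l {u1 u2 v1 v2} => ?? [].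
rewrite (_ : (fun i => _) = (fun i => Re (u i) * Im (v i) + Im (u i) * Re (v i))).
  by apply: cvgD; exact: cvgM.
by apply/funext => i; case: (u i) (v i) => ?? [].
Qed.

Lemma ccvg_conj u l : ccvg u l -> ccvg (fun i => (u i)^*%C) l^*%C.
Proof.
move=> [u1 u2]; split.
  rewrite (_ : Re l^*%C = Re l); last by case: l {u1 u2}.
  rewrite (_ : (fun i => _) = (fun i => Re (u i)))//.
  by apply/funext => i; case: (u i).
rewrite (_ : Im l^*%C = - Im l); last by case: l {u1 u2}.
rewrite (_ : (fun i => _) = (fun i => - Im (u i))); first exact: cvgN.
by apply/funext => i; case: (u i).
Qed.

Lemma ccvg_real (x : nat -> R) (l : R) : x @ \oo --> l -> ccvg (fun i => (x i)%:C%C) l%:C%C.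
Proof. by move=> h; split => //; exact: cvg_cst. Qed.

Definition mcvg M (L : mat2 C) :=
  [/\ ccvg (fun i => ma (M i)) (ma L), ccvg (fun i => mb (M i)) (mb L),
      ccvg (fun i => mc (M i)) (mc L) & ccvg (fun i => md (M i)) (md L)].

Lemma mcvg_cst L : mcvg (fun=> L) L.
Proof. by split; exact: ccvg_cst. Qed.

Lemma mcvgM M N K L : mcvg M K -> mcvg N L ->
  mcvg (fun i => mmul (M i) (N i)) (mmul K L).
Proof.
by move=> [????] [????]; split; apply: ccvgD; exact: ccvgM.
Qed.

Lemma mcvg_star M L : mcvg M L -> mcvg (fun i => mstar (M i)) (mstar L).
Proof. by move=> [????]; split; exact: ccvg_conj. Qed.

Lemma act_cvg M L (x : 'rV[R]_4) k : mcvg M L ->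
  (fun i => act (M i) x 0 k) @ \oo --> act L x 0 k.
Proof.
move=> h; have h' := mcvg_star h.
have [[a1 a2] [b1 b2] [c1 c2] [d1 d2]] := mcvgM (mcvgM h (mcvg_cst (herm x))) h'.
rewrite /act /unherm mxE.
rewrite (_ : (fun i => _) = (fun i =>
  let X := mmul (mmul (M i) (herm x)) (mstar (M i)) in nth 0
  [:: (Re (ma X) + Re (md X)) / 2; Re (mb X); Im (mb X);
      (Re (ma X) - Re (md X)) / 2] k)); last by apply/funext => i; rewrite mxE.
case: k => -[|[|[|[|//]]]] k4 //=.
- by apply: cvgMr_tmp; apply: cvgD.
- by apply: cvgMr_tmp; apply: cvgB.
Qed.

Lemma acosh_cvg1 (u : nat -> R) : u @ \oo --> (1 : R) -> (fun i => acosh (u i)) @ \oo --> (0 : R).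
Proof.
move=> u1; rewrite /acosh -[X in _ --> X](@ln1 R).
have c : (fun i => u i + Num.sqrt (u i ^+ 2 - 1)) @ \oo --> (1 : R).
  rewrite -[X in _ --> X]addr0; apply: cvgD => //.
  rewrite -[X in _ --> X](@sqrtr0 R); apply: continuous_cvg; first exact: sqrt_continuous.
  rewrite (_ : 0 = 1 ^+ 2 - 1 :> R); last by rewrite expr1n subrr.
  by apply: cvgB; [apply: cvgM|exact: cvg_cst].
by apply: continuous_cvg => //; exact: continuous_ln.
Qed.

Lemma to_isom_cvg M L : (forall i, mdet (M i) = 1) -> mdet L = 1 -> mcvg M L ->
  (fun i => to_isom (M i)) @ \oo --> to_isom L.
Proof.
move=> M1 L1 h; apply: eval_cvg_isom => x; apply/cvg_mdistP => e e0.
have : (fun i => acosh (- lorentz (to_isom L x) (to_isom (M i) x))) @ \oo --> (0 : R).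
  apply: acosh_cvg1; rewrite -(lorentzxx (to_isom L x)).
  rewrite (_ : (fun i => _) = (fun i => - lorentz (act L x) (act (M i) x))); last first.
    by apply/funext => i; rewrite !to_isomE.
  rewrite to_isomE// lorentz4; under eq_fun do rewrite lorentz4.
  apply: cvgN; repeat apply: cvgD; try apply: cvgN;
    by apply: cvgM; [exact: cvg_cst|exact: act_cvg].
move=> /cvgrPdist_lt/(_ _ e0); apply: filterS => i /=.
by rewrite sub0r normrN; apply: le_lt_trans; exact: ler_norm.
Qed.

End MatrixConvergence.

(** * Displacement of a base point *)

Section BasePoint.
Variable R : realType.
Local Notation C := R[i].
Implicit Types g : mat2 C.

Lemma origin_subproof (v := @unherm R mone) : (lorentz v v == -1) && (0 < v 0 ord0).
Proof. by rewrite lorentz4 !mxE /=; apply/andP; split; [apply/eqP|]; lra. Qed.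

Definition origin : hyp3 R := Hyp3 (unherm mone) origin_subproof.

Lemma act_origin g : act g origin 0 ord0 =
  (cn (ma g) ^+ 2 + cn (mb g) ^+ 2 + cn (mc g) ^+ 2 + cn (md g) ^+ 2) / 2.
Proof.
rewrite !cn_sqr; case: g => -[a a'] [b b'] [c c'] [d d'].
by rewrite !mxE /= !mxE /=; lra.
Qed.

Lemma cosh_mdist_origin g : mdet g = 1 ->
  acosh (act g origin 0 ord0) = mdist origin (to_isom g origin).
Proof.
move=> g1; rewrite [RHS]/mdist /= /hdist to_isomE//; congr acosh.
by rewrite lorentz4 !mxE /=; lra.
Qed.

Lemma act_origin_ge1 g : mdet g = 1 -> 1 <= act g origin 0 ord0.
Proof.
move=> g1; have := lorentz_ge1 origin (to_isom g origin).
by rewrite to_isomE// lorentz4 !mxE /=; lra.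
Qed.

(** The time coordinate of the image of [origin] is the cosh of the displacement and half the sum of
    the squared moduli of the entries. *)
Lemma mc_le_mdist g : mdet g = 1 ->
  cn (mc g) ^+ 2 <= 2 * expR (mdist origin (to_isom g origin)).
Proof.
move=> g1; rewrite -cosh_mdist_origin//; have := act_origin_ge1 g1.
have : cn (mc g) ^+ 2 <= 2 * act g origin 0 ord0.
  by rewrite act_origin; have := sqr_ge0 (cn (ma g)); have := sqr_ge0 (cn (mb g));
    have := sqr_ge0 (cn (md g)); lra.
move: (act g origin 0 ord0) => t ht t1; apply: le_trans ht _; rewrite ler_pM2l//.
rewrite /acosh lnK; first by rewrite lerDl sqrtr_ge0.
by rewrite posrE (lt_le_trans (_ : 0 < t))// ?lerDl ?sqrtr_ge0//; lra.
Qed.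

Lemma mdist_ge_mc g : mdet g = 1 -> 2 <= cn (mc g) ->
  ln 2 <= mdist origin (to_isom g origin).
Proof.
move=> g1 h; rewrite -(ler_expR (ln 2)) lnK ?posrE//.
have := mc_le_mdist g1; have : 4 <= cn (mc g) ^+ 2 by nra.
by lra.
Qed.

Lemma mc_bounded (psi : nat -> mat2 C) (g : isom R) : (forall i, mdet (psi i) = 1) ->
  (fun i => to_isom (psi i)) @ \oo --> g ->
  exists B, \forall i \near \oo, cn (mc (psi i)) <= B.
Proof.
move=> d1 /(@cvg_isom_eval R _ _ origin)/cvg_mdistP/(_ _ ltr01) h.
exists (2 * expR (mdist origin (g origin) + 1)); apply: filterS h => i hi.
set E := expR _; have E1 : 1 <= E.
  by rewrite -expR0 ler_expR addr_ge0 ?mdist_ge0.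
have := mc_le_mdist (d1 i).
have : expR (mdist origin (to_isom (psi i) origin)) <= E.
  by rewrite ler_expR (le_trans (metric_triangle _ (g origin) _))// lerD2l ltW.
by have := cn_ge0 (mc (psi i)); nra.
Qed.

End BasePoint.

(** * The group G and its once-punctured torus subgroup *)

Inductive gen := GX | GY | GT.
Definition letter := (gen * bool)%type.
Definition word := seq letter.

Definition linv (l : letter) : letter := (l.1, ~~ l.2).
Definition winv (w : word) : word := rev (map linv w).
Definition is_GT (l : letter) := if l.1 is GT then true else false.
Definition noT (w : word) := all (fun l => ~~ is_GT l) w.

Definition lmat (K : comNzRingType) (th : K) (l : letter) : mat2 K :=
  match l with
  | (GX, false) => Mat2 2 (-1) (-1) 1
  | (GX, true) => Mat2 1 1 1 2
  | (GY, false) => Mat2 2 1 1 1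
  | (GY, true) => Mat2 1 (-1) (-1) 2
  | (GT, false) => Mat2 1 th 0 1
  | (GT, true) => Mat2 1 (- th) 0 1
  end.

Arguments lmat : simpl never.

Definition ev (K : comNzRingType) (th : K) (w : word) : mat2 K :=
  foldr (fun l M => mmul (lmat th l) M) mone w.

(** Its reductions modulo k define the cyclic covers. T moves like X so that conjugation by T
    carries the lift of the commutator at one vertex to the lift at the next. *)
Definition lpos (l : letter) : int :=
  match l with
  | (GY, _) => 0
  | (_, false) => 1
  | (_, true) => -1
  end.
Arguments lpos : simpl never.
Definition pos (w : word) : int := foldr (fun l n => lpos l + n) 0 w.

Lemma winv_cons l w : winv (l :: w) = winv w ++ [:: linv l].
Proof. by rewrite /winv /= rev_cons cats1. Qed.

Section Evaluation.
Variables (K : comNzRingType) (th : K).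

Lemma ev_cons l w : ev th (l :: w) = mmul (lmat th l) (ev th w). Proof. by []. Qed.

Lemma ev_cat w w' : ev th (w ++ w') = mmul (ev th w) (ev th w').
Proof. by elim: w => [|l w IH]; rewrite ?mmul1//= IH mmulA. Qed.

Lemma lmat_det l : mdet (lmat th l) = 1.
Proof. by case: l => -[] []; rewrite /lmat /mdet /=; ring. Qed.

Lemma ev_det w : mdet (ev th w) = 1.
Proof. by elim: w => [|l w IH]; rewrite ?mdet1// mdetM IH lmat_det mulr1. Qed.

Lemma lmat_inv l : lmat th (linv l) = minv (lmat th l).
Proof. by case: l => -[] []; apply: mat2P => /=; ring. Qed.

Lemma ev_winv w : ev th (winv w) = minv (ev th w).
Proof.
elim: w => [|l w IH]; first by rewrite minv1.
by rewrite winv_cons ev_cat IH ev_cons mmulr1 lmat_inv minvM.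
Qed.

End Evaluation.

Lemma linvK : involutive linv.
Proof. by case=> g b; rewrite /linv /= negbK. Qed.

Lemma noT_winv w : noT (winv w) = noT w.
Proof. by rewrite /noT /winv all_rev all_map; apply: eq_all => -[]. Qed.

Lemma pos_cat w w' : pos (w ++ w') = pos w + pos w'.
Proof. by elim: w => [|l w IH] /=; rewrite ?add0r// IH addrA. Qed.

Lemma lpos_inv l : lpos (linv l) = - lpos l.
Proof. by case: l => -[] []. Qed.

Lemma pos_winv w : pos (winv w) = - pos w.
Proof.
elim: w => [//|l w IH]; rewrite winv_cons pos_cat IH /= lpos_inv addr0.
by rewrite opprD addrC.
Qed.

Definition mmap (K K' : comNzRingType) (f : K -> K') (M : mat2 K) : mat2 K' :=
  Mat2 (f (ma M)) (f (mb M)) (f (mc M)) (f (md M)).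

Lemma ev_map (K K' : comNzRingType) (f : {rmorphism K -> K'}) th w :
  ev (f th) w = mmap f (ev th w).
Proof.
elim: w => [|l w IH]; first by apply: mat2P; rewrite /= ?rmorph0 ?rmorph1.
rewrite ev_cons IH; case: l => -[] []; apply: mat2P => /=;
by rewrite !(rmorphD, rmorphM, rmorphN, rmorph0, rmorph1, rmorph_nat).
Qed.

Lemma ev_noT (K : comNzRingType) (th th' : K) w : noT w -> ev th w = ev th' w.
Proof. by elim: w => [//|[[] b] w IH] //= /IH ->. Qed.

(* A word is a path in the graph with vertex set [int] whose edges are [X] and [T]
   from [j] to [j + 1], labelled [al j] and [ga j], and loops [Y] at [j], labelled
   [be j]. Below, [be] is an affine function of [j]; this is exactly what makes the
   sum of the labels compatible with the relation [T, [X, Y]] = 1. *)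
Section PathSum.
Variables (A : zmodType) (al be ga : int -> A).

Definition lval (j : int) (l : letter) : A :=
  match l with
  | (GX, false) => al j
  | (GX, true) => - al (j - 1)
  | (GY, false) => be j
  | (GY, true) => - be j
  | (GT, false) => ga j
  | (GT, true) => - ga (j - 1)
  end.

Arguments lval : simpl never.

Fixpoint psum (j : int) (w : word) : A :=
  if w is l :: w' then lval j l + psum (j + lpos l) w' else 0.

Lemma psum_cat (j : int) w w' : psum j (w ++ w') = psum j w + psum (j + pos w) w'.
Proof. by elim: w j => [|l w IH] j /=; rewrite ?add0r ?addr0// IH !addrA. Qed.

Lemma lval_inv (j : int) l : lval (j + lpos l) (linv l) = - lval j l.
Proof. by case: l => -[] []; rewrite /lpos /lval /= ?addrK ?subrK ?addr0 ?opprK. Qed.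

Lemma psum_winv (j : int) w : psum (j + pos w) (winv w) = - psum j w.
Proof.
elim: w j => [|l w IH] j; first by rewrite /= oppr0.
rewrite winv_cons psum_cat /= pos_winv addr0 addrA IH addrK lval_inv.
by rewrite opprD [RHS]addrC.
Qed.

End PathSum.
Arguments lval : simpl never.

Definition affine (A : zmodType) (b : A) (be : int -> A) :=
  forall j : int, be (j + 1) = be j + b.

(* The equalities that hold in the group <X, Y, T | [T, [X, Y]] = 1>, as seen by
   matrices and path sums. *)
Definition weq (w w' : word) := [/\ pos w = pos w',
  forall (K : comNzRingType) (th : K), ev th w = ev th w' &
  forall (A : zmodType) (al be ga : int -> A) (b : A), affine b be ->
    forall j : int, psum al be ga j w = psum al be ga j w'].

Lemma weq_sym w w' : weq w w' -> weq w' w.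
Proof. by move=> [h1 h2 h3]; split=> // *; rewrite ?h2//; symmetry; apply: h3; eassumption. Qed.
Lemma weq_trans w2 w1 w3 : weq w1 w2 -> weq w2 w3 -> weq w1 w3.
Proof.
move=> [h1 h2 h3] [k1 k2 k3]; split=> [|K th|A al be ga b hb j].
- by rewrite h1.
- by rewrite h2.
- by rewrite (h3 _ _ _ _ b)// (k3 _ _ _ _ b).
Qed.
Lemma weq_cat w1 w1' w2 w2' :
  weq w1 w1' -> weq w2 w2' -> weq (w1 ++ w2) (w1' ++ w2').
Proof.
move=> [h1 h2 h3] [k1 k2 k3]; split=> [|K th|A al be ga b hb j].
- by rewrite !pos_cat h1 k1.
- by rewrite !ev_cat h2 k2.
- by rewrite !psum_cat (h3 _ _ _ _ b)// (k3 _ _ _ _ b)// h1.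
Qed.
Lemma weq_cancel l : weq [:: l; linv l] [::].
Proof.
split=> [|K th|A al be ga b hb j] /=.
- by rewrite lpos_inv addr0 subrr.
- by rewrite mmulr1 lmat_inv mmulrV// lmat_det.
- by rewrite addr0 lval_inv subrr.
Qed.
Lemma weq_mulwV w : weq (w ++ winv w) [::].
Proof.
split=> [|K th|A al be ga b hb j] /=.
- by rewrite pos_cat pos_winv subrr.
- by rewrite ev_cat ev_winv mmulrV// ev_det.
- by rewrite psum_cat psum_winv subrr.
Qed.
Lemma weq_mulVw w : weq (winv w ++ w) [::].
Proof.
have wK : winv (winv w) = w.
  by rewrite /winv map_rev revK (mapK linvK).
by have := weq_mulwV (winv w); rewrite wK.
Qed.

(** * Freeness of the group generated by X and Y *)

Definition cancels (l l' : letter) := match l, l' with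
  | (GX, b), (GX, b') | (GY, b), (GY, b') | (GT, b), (GT, b') => b != b'
  | _, _ => false
  end.

Fixpoint reduced (w : word) := if w is l :: w' then
  (if w' is l' :: _ then ~~ cancels l l' else true) && reduced w' else true.

Lemma cancelsE l l' : cancels l l' -> l' = linv l.
Proof. by case: l l' => -[] [] [] [] []. Qed.

Lemma not_reduced w : ~~ reduced w ->
  exists w1 l w2, w = w1 ++ [:: l; linv l] ++ w2.
Proof.
elim: w => [//|l [//|l' w] IH]; rewrite [reduced _]/= negb_and negbK.
case/orP => [/cancelsE ->|/IH[w1 [k [w2 ->]]]]; first by exists [::], l, w.
by exists (l :: w1), k, w2.
Qed.

(* [out l] is the interval of the projective line into which [l] maps everything
   outside [out (linv l)]; the four of them are cut out by -1, 0, 1, oo. *)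
Definition out (l : letter) (p q : int) : bool :=
  match l with
  | (GX, false) => q * (p + q) < 0
  | (GX, true) => 0 < p * (q - p)
  | (GY, false) => 0 < q * (p - q)
  | (GY, true) => p * (q + p) < 0
  | _ => false
  end.

Definition app (M : mat2 int) (v : int * int) :=
  (ma M * v.1 + mb M * v.2, mc M * v.1 + md M * v.2).

Arguments app : simpl never.

Lemma app_mul M N v : app (mmul M N) v = app M (app N v).
Proof. by rewrite /app; congr (_, _); rewrite /=; ring. Qed.

Lemma out_step l l' v : ~~ is_GT l -> ~~ cancels l l' -> out l' v.1 v.2 ->
  let u := app (lmat 0 l) v in out l u.1 u.2.
Proof.
case: v => p q; case: l l' => -[] [] [] [] [] //= _ _; rewrite /app /lmat /=; nia.
Qed.

Lemma out_word w s v : noT w -> reduced (rcons w s) -> out s v.1 v.2 ->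
  let u := app (ev 0 w) v in out (head s w) u.1 u.2.
Proof.
elim: w => [_ _|l w IH]; first by case: v => p q; rewrite /app /= !mul1r !mul0r !(addr0, add0r).
move=> /andP[lT wT] rw os; rewrite ev_cons app_mul; apply: (@out_step l (head s w)) => //.
  by case: w {IH wT} rw => [|l' w] /andP[].
by apply: IH => //; case/andP: rw.
Qed.

Definition test_vec (l : letter) : int * int :=
  match l with
  | (GX, false) => (-2, 1)
  | (GX, true) => (1, 2)
  | (GY, false) => (2, 1)
  | _ => (-1, 2)
  end.

Lemma out_opp l p q : out l (- p) (- q) = out l p q.
Proof. by case: l => -[] []; rewrite /out //; congr (_ < _); ring. Qed.

Lemma reduced_rcons l w s :
  reduced (rcons (l :: w) s) = reduced (l :: w) && ~~ cancels (last l w) s.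
Proof.
elim: w l => [|k w IH] l; first by rewrite /= andbT.
by have := IH k; rewrite /= => ->; rewrite andbA.
Qed.

Lemma noT_last l w : noT (l :: w) -> ~~ is_GT (last l w).
Proof. by elim: w l => [|k w IH] l /= /andP[lT wT] //; exact: IH. Qed.

(** Ping-pong: the word sends a test point outside [out l] into [out l], so it acts nontrivially on
    the projective line, which excludes the identity and its negative together. *)
Lemma reduced_neq1 l w : noT (l :: w) -> reduced (l :: w) ->
  ev 0 (l :: w) <> mone :> mat2 int /\ ev 0 (l :: w) <> mopp mone :> mat2 int.
Proof.
move=> wT wr; set k := last l w.
have kT : ~~ is_GT k := noT_last wT.
(* The letter [s] must neither cancel the last letter nor equal the first one; the four intervals
   leave room for both. *)
have [s [ks os no]] : exists s, [/\ ~~ cancels k s,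
    out s (test_vec s).1 (test_vec s).2 & ~~ out l (test_vec s).1 (test_vec s).2].
  have lT : ~~ is_GT l by case/andP: wT.
  case: l @k kT lT {wT wr} => -[] b k //; case: k => -[] c // _ _.
  - by exists (GY, false); case: b.
  - by exists (GY, c); case: b c => -[].
  - by exists (GX, c); case: b c => -[].
  - by exists (GX, false); case: b.
have rs : reduced (rcons (l :: w) s) by rewrite reduced_rcons wr.
have ol := out_word wT rs os; cbv zeta in ol.
split=> e; move: ol no; rewrite e /app /=.
  by rewrite !mul1r !mul0r addr0 add0r => ->.
by rewrite !mulN1r !oppr0 !mul0r addr0 add0r out_opp => ->.
Qed.

Lemma free_weq w : noT w -> ev 0 w = mone :> mat2 int \/ ev 0 w = mopp mone :> mat2 int ->
  weq w [::].
Proof.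
have [n] := ubnP (size w); elim: n w => // n IH w wn wT w1.
have [wr|/not_reduced[w1' [l [w2 e]]]] := boolP (reduced w).
  case: w wT wr w1 {wn} => // l w wT wr; have [h1 h2] := reduced_neq1 wT wr.
  by case.
have ww : weq w (w1' ++ w2).
  rewrite e; apply: weq_cat => //.
  by rewrite -[X in weq _ X]cat0s; apply: weq_cat => //; exact: weq_cancel.
apply: (weq_trans ww); apply: IH.
- by move: wn; rewrite e !size_cat /= ltnS; lia.
- by move: wT; rewrite e /noT !all_cat /= => /and3P[-> /and3P[_ _ _] ->].
- by case: ww => _ <- _.
Qed.

(* [XYX^-1Y^-1 = - (1, -6; 0, 1)] generates the stabilizer of infinity in <X, Y>. *)
Definition comm : word := [:: (GX, false); (GY, false); (GX, true); (GY, true)].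

Lemma psum_comm (A : zmodType) (al be ga : int -> A) b (j : int) : affine b be ->
  psum al be ga j comm = b.
Proof.
move=> hb; rewrite /= /lval /lpos /= !addr0 addrK hb.
by rewrite -opprD addrA [al j + _]addrA addrAC subrr add0r.
Qed.

Lemma comm_power (m : int) : exists w (n : int),
  [/\ noT w, pos w = 0,
   ev 0 w = Mat2 1 (6 * m) 0 1 :> mat2 int \/ ev 0 w = Mat2 (-1) (- (6 * m)) 0 (-1) :> mat2 int &
   forall (A : zmodType) (al be ga : int -> A) b, affine b be ->
     forall j : int, psum al be ga j w = b *~ n].
Proof.
(* Here [e] is [comm], with [d] = -1, or its inverse, with [d] = 1. The sign of the matrix
   alternates with the exponent, hence the disjunction. *)
have step (e : word) (d : int) (k : nat) : noT e -> pos e = 0 ->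
  ev 0 e = Mat2 (-1) (- (6 * d)) 0 (-1) :> mat2 int ->
  (forall (A : zmodType) (al be ga : int -> A) b, affine b be ->
     forall j : int, psum al be ga j e = b *~ - d) ->
  exists w (n : int), [/\ noT w, pos w = 0,
   ev 0 w = Mat2 1 (6 * (d * k%:Z)) 0 1 :> mat2 int \/
     ev 0 w = Mat2 (-1) (- (6 * (d * k%:Z))) 0 (-1) :> mat2 int &
   forall (A : zmodType) (al be ga : int -> A) b, affine b be ->
     forall j : int, psum al be ga j w = b *~ n].
  move=> eT e0 ee ev'; elim: k => [|k [w [n [wT w0 ew vw]]]].
    by exists [::], 0; split=> //; left; rewrite mulr0 mulr0.
  exists (e ++ w), (- d + n); split.
  - by rewrite /noT all_cat; apply/andP.
  - by rewrite pos_cat e0 w0.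
  - by rewrite ev_cat ee; case: ew => ->; [right|left]; apply: mat2P => /=; lia.
  - move=> A al be ga b hb j; rewrite psum_cat (ev' _ _ _ _ _ hb) (vw _ _ _ _ _ hb).
    by rewrite mulrzDr.
have vinv (A : zmodType) (al be ga : int -> A) b : affine b be ->
    forall j : int, psum al be ga j (winv comm) = b *~ - 1.
  by move=> hb j; have := psum_winv al be ga j comm; rewrite (psum_comm _ _ _ hb) mulrN1z addr0.
case: m => k.
  by rewrite -[Posz k]mul1r; apply: (step (winv comm)) => // A al be ga b; exact: vinv.
rewrite NegzE -(mulN1r k.+1%:Z); apply: (step comm) => //.
by move=> A al be ga b hb j; rewrite opprK (psum_comm _ _ _ hb).
Qed.

(** * Residues modulo 2 and 3, and the stabilizer of infinity *)

Section Residues.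
Variable p : nat.
Let t (M : mat2 'Z_p) : seq 'Z_p := [:: ma M; mb M; mc M; md M].

Lemma ev_residues (L : seq (seq 'Z_p)) :
  t mone \in L ->
  (forall l a b c d, ~~ is_GT l -> [:: a; b; c; d] \in L -> t (mmul (lmat 0 l) (Mat2 a b c d)) \in L) ->
  forall w, noT w -> t (ev 0 w) \in L.
Proof.
move=> L1 LM; elim=> [//|l w IH] /= /andP[lT /IH]; set M := ev 0 w => ML.
by have := LM l (ma M) (mb M) (mc M) (md M) lT ML.
Qed.

End Residues.

(** Modulo 2, both X and Y generate the same group of order 3, where only the identity has lower
    left entry 0. *)
Lemma ev_mod2 w : noT w -> mc (ev 0 w) = 0 :> 'Z_2 -> mb (ev 0 w) = 0 :> 'Z_2.
Proof.
pose L : seq (seq 'Z_2) := [:: [:: 1; 0; 0; 1]; [:: 1; 1; 1; 0]; [:: 0; 1; 1; 1]].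
move=> wT; have := @ev_residues 2 L isT _ w wT.
move: (ev 0 w) => [a b c d] /=.
have h l a' b' c' d' : ~~ is_GT l -> [:: a'; b'; c'; d'] \in L ->
  [:: ma (mmul (lmat 0 l) (Mat2 a' b' c' d')); mb (mmul (lmat 0 l) (Mat2 a' b' c' d'));
   mc (mmul (lmat 0 l) (Mat2 a' b' c' d')); md (mmul (lmat 0 l) (Mat2 a' b' c' d'))] \in L.
  case: l => -[] [] // _; rewrite !inE => /or3P[] /eqP[-> -> -> ->]; by vm_compute.
by move=> /(_ h); rewrite !inE => /or3P[] /eqP[_ -> -> _].
Qed.

(** The quaternion group, image of <X, Y> in SL_2(Z/3). Only its center has lower left entry 0, and
    only its identity has trace -1; the first fact serves the stabilizer of infinity, the second the
    absence of 3-torsion. *)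
Definition Q8_mod3 : seq (seq 'Z_3) :=
  [:: [:: 1; 0; 0; 1]; [:: -1; 0; 0; -1]; [:: 0; 1; -1; 0]; [:: 0; -1; 1; 0];
      [:: 1; 1; 1; -1]; [:: -1; -1; -1; 1]; [:: 1; -1; -1; -1]; [:: -1; 1; 1; 1]].

Lemma ev_mod3 w : noT w ->
  [:: ma (ev 0 w); mb (ev 0 w); mc (ev 0 w); md (ev 0 w)] \in Q8_mod3.
Proof.
apply: ev_residues => // l a b c d.
case: l => -[] [] // _; rewrite !inE => /or4P[|||/or4P[|||/orP[]]] /eqP[-> -> -> ->];
  by vm_compute.
Qed.

Lemma dvdz_Zp (p : nat) (x : int) : prime p -> (p %| x)%Z = (x%:~R == 0 :> 'Z_p).
Proof.
move=> pp; apply: (@dvdz_pcharf 'Z_p).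
by apply/andP; split; rewrite //= pchar_Zp ?prime_gt1.
Qed.

Lemma ev_Zp (p : nat) w : ev (0 : 'Z_p) w = mmap (intr : int -> 'Z_p) (ev 0 w).
Proof. by rewrite -(ev_map (intr : {rmorphism int -> 'Z_p})) rmorph0. Qed.

Lemma ev_stab_dvd6 w : noT w -> mc (ev 0 w) = 0 :> int ->
  exists m : int, mb (ev 0 w) = 6 * m.
Proof.
move=> wT c0.
have d2 : (2 %| mb (ev 0 w : mat2 int))%Z.
  rewrite (@dvdz_Zp 2)//; apply/eqP.
  have := @ev_mod2 w wT; rewrite !ev_Zp /= c0 rmorph0; exact.
have d3 : (3 %| mb (ev 0 w : mat2 int))%Z.
  rewrite (@dvdz_Zp 3)//; have := @ev_mod3 w wT; rewrite !ev_Zp /= c0 rmorph0.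
  by rewrite !inE => /or4P[|||/or4P[|||/orP[]]] /eqP[_ -> // _].
have : ((2 * 3)%:Z %| mb (ev 0 w : mat2 int))%Z by rewrite PoszM Gauss_dvdz// d2 d3.
by case/dvdzP => m ->; exists m; rewrite mulrC.
Qed.

(* The words in X, Y that fix infinity are, up to equality in the group, powers of
   [comm]; in particular they commute with T. *)
Lemma stab_weq w : noT w -> mc (ev 0 w) = 0 :> int ->
  [/\ pos w = 0,
   exists (b : int) (e : bool), ev 0 w = Mat2 ((-1) ^+ e) b 0 ((-1) ^+ e) :> mat2 int,
   (exists n : int, forall (A : zmodType) (al be ga : int -> A) b, affine b be ->
     forall j : int, psum al be ga j w = b *~ n) &
   mb (ev 0 w) = 0 :> int -> weq w [::]].
Proof.
move=> wT c0; have [m bm] := ev_stab_dvd6 wT c0.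
have [e ew] : exists e : bool, ev 0 w = Mat2 ((-1) ^+ e) (6 * m) 0 ((-1) ^+ e) :> mat2 int.
  have : mdet (ev 0 w : mat2 int) = 1 := ev_det _ _.
  move: bm c0; case: (ev 0 w) => a b c d /= -> -> ; rewrite /mdet /= mulr0 subr0 => ad.
  have [a1|a1] : a = 1 \/ a = -1.
    move: ad => /(congr1 absz)/eqP; rewrite abszM muln_eq1 => /andP[/eqP].
    by case: a => a /=; lia.
    by exists false; rewrite a1 (_ : d = 1)//; nia.
  by exists true; rewrite a1 (_ : d = -1)//; nia.
(* As a Möbius map [w] is the translation by 6 (-1)^e m; dividing by the power of [comm] with the
   same translation leaves the identity up to sign, to which freeness applies. *)
have [v [n [vT v0 ev_v val_v]]] := comm_power ((-1) ^+ e * m).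
have wv : weq (w ++ winv v) [::].
  apply: free_weq; first by rewrite /noT all_cat -!/(noT _) wT noT_winv.
  rewrite ev_cat ev_winv ew; case: ev_v => ->; case: e {ew v vT v0 val_v};
    first [by left; apply: mat2P => /=; ring|by right; apply: mat2P => /=; ring].
have wv' : weq w v.
  apply: (weq_trans (w2 := (w ++ winv v) ++ v)).
    rewrite -catA -[X in weq X _]cats0; apply: weq_cat => //.
    by apply: weq_sym; exact: weq_mulVw.
  by rewrite -[X in weq _ X]cat0s; exact: weq_cat.
case: (wv') => p1 p2 p3; split.
- by rewrite p1.
- by exists (6 * m), e.
- by exists n => A al be ga b hb j; rewrite (p3 _ _ _ _ b)//; exact: val_v.
- move=> b0; apply: free_weq => //; rewrite ew in b0 *; move: b0 => /= ->.
  by case: e {ew ev_v val_v}; [right|left]; apply: mat2P => /=; ring.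
Qed.

(** * Discreteness of G *)

Definition tpow (n : int) : word := nseq `|n|%N (GT, n < 0).

Lemma weq_tpow b n : weq ((GT, b) :: tpow n) (tpow (n + lpos (GT, b))).
Proof.
have e l k : weq (l :: linv l :: nseq k (linv l)) (nseq k (linv l)).
  by rewrite -[X in weq _ X]cat0s; apply: (@weq_cat [:: _; _]) => //; exact: weq_cancel.
case: b n => -[n|n]; rewrite /lpos.
- case: n => [//|n]; rewrite (_ : Posz n.+1 + -1 = n); last by lia.
  exact: (e (GT, true)).
- by rewrite (_ : Negz n + -1 = Negz n.+1); last by lia.
- by rewrite (_ : Posz n + 1 = n.+1); last by lia.
- case: n => [|n]; first exact: (e (GT, false) 0%N).
  rewrite (_ : Negz n.+1 + 1 = Negz n); last by lia.
  exact: (e (GT, false) n.+1).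
Qed.

Lemma tpow_Posz (n : nat) : tpow n = nseq n (GT, false). Proof. by []. Qed.
Lemma tpow_Negz (n : nat) : tpow (Negz n) = nseq n.+1 (GT, true). Proof. by []. Qed.

Lemma ev_tpow (K : comNzRingType) (th : K) n : ev th (tpow n) = Mat2 1 (n%:~R * th) 0 1.
Proof.
case: n => n.
  rewrite tpow_Posz -pmulrn; elim: n => [|n IH]; first by apply: mat2P => /=; rewrite ?mul0r.
  by rewrite /= IH /lmat; apply: mat2P => /=; rewrite ?mulrS; ring.
rewrite tpow_Negz NegzE rmorphN /= -pmulrn; elim: n => [|n IH].
  by rewrite /= /lmat; apply: mat2P => /=; ring.
rewrite [ev th _]/= IH /lmat.
by apply: mat2P => /=; rewrite ?[n.+2%:R]mulrS; ring.
Qed.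

Lemma ev_noT_int (K : comNzRingType) (th : K) w : noT w ->
  ev th w = mmap (intr : int -> K) (ev 0 w).
Proof.
by move=> wT; rewrite (ev_noT _ 0 wT) -(ev_map (intr : {rmorphism int -> K})) rmorph0.
Qed.

(** For path sums, T only shifts the vertex at which [u] is read, and since [be] is affine the sum
    along [u] is the same at every vertex. *)
Lemma stab_commute u n : noT u -> mc (ev 0 u) = 0 :> int ->
  weq (u ++ tpow n) (tpow n ++ u).
Proof.
move=> uT u0; have [p0 [b [e eu]] [k vk] _] := stab_weq uT u0.
split=> [|K th|A al be ga c hc j].
- by rewrite !pos_cat addrC.
- rewrite !ev_cat (ev_noT_int _ uT) eu ev_tpow; apply: mat2P => /=;
  rewrite !(rmorph0, rmorphXn, rmorphN1); ring.
- by rewrite !psum_cat p0 addr0 !(vk _ _ _ _ c) ?hc// addrC.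
Qed.

Definition flat (l : seq (word * int)) : word := flatten [seq v.1 ++ tpow v.2 | v <- l].

Fixpoint nf_tail (l : seq (word * int)) : Prop :=
  if l is (v, n) :: l' then
    [/\ noT v, mc (ev 0 v) <> 0 :> int, l' = [::] \/ n <> 0 & nf_tail l']
  else True.

(* The normal form in the amalgam of <X, Y> and <T, comm> along <comm>. *)
Lemma normal_form w : exists n u l,
  [/\ noT u, mc (ev 0 u) = 0 :> int, nf_tail l & weq w (tpow n ++ u ++ flat l)].
Proof.
elim: w => [|s w [n [u [l [uT u0 nl wE]]]]]; first by exists 0, [::], [::].
have sE : weq (s :: w) (s :: tpow n ++ u ++ flat l) by apply: (@weq_cat [:: s] [:: s]).
have [sT|sT] := boolP (is_GT s).
  exists (n + lpos s), u, l; split => //; apply: (weq_trans sE).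
  rewrite -cat_cons; apply: weq_cat => //.
  by case: s sT {sE} => -[] // b _; exact: weq_tpow.
have s0 : mc (ev 0 [:: s]) <> 0 :> int by case: s sT {sE} => -[] [].
have noTs v : noT (s :: v) = noT v by rewrite /noT /= sT.
have su0 : mc (ev 0 (s :: u)) <> 0 :> int.
  have [_ [b [e eu]] _ _] := stab_weq uT u0.
  move: s0; rewrite !ev_cons eu /= !mulr1 !mulr0 !addr0 => s0 /eqP.
  by rewrite mulf_eq0 signr_eq0 orbF => /eqP.
have [n0|n0] := eqVneq n 0; last first.
  exists 0, [::], ((s :: u, n) :: l); split => //.
    by split=> //; [rewrite noTs|right; apply/eqP].
  apply: (weq_trans sE); rewrite /flat /= -/(flat l) -!cat_cons !catA.
  apply: weq_cat => //; apply: (@weq_cat [:: s] [:: s]) => //.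
  by apply: weq_sym; exact: stab_commute.
rewrite {}n0 /= in sE; case: l nl {wE} sE => [|[v m] l].
  move=> _ sE; exists 0, [::], [:: (s :: u, 0)]; split => //.
    by split => //; [rewrite noTs|left].
  by rewrite /flat /= !cats0 in sE *.
move=> [vT v0 lm nl] sE; set v' := s :: u ++ v.
have v'T : noT v' by rewrite noTs /noT all_cat; apply/andP.
have {}sE : weq (s :: w) (v' ++ tpow m ++ flat l).
  by apply: (weq_trans sE); rewrite /flat /= -/(flat l) -!catA.
(* The merged product may fall back into the stabilizer of infinity; it then becomes the new head,
   and T^m moves past it to the front. *)
have [e|e] := eqVneq (mc (ev 0 v' : mat2 int)) 0.
  exists m, v', l; split => //; apply: (weq_trans sE); rewrite !catA.
  by apply: weq_cat => //; exact: stab_commute.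
exists 0, [::], ((v', m) :: l); split => //; first by split => //; exact/eqP.
by rewrite /flat /= -/(flat l) -?catA in sE *.
Qed.

(** * Ping-pong on the complex plane *)

Section Geometry.
Variable R : realType.
Local Notation C := R[i].

(** Long compared with the strip |Im z| <= 1 used for ping-pong; even, so that the midpoint 6i is a
    Gaussian integer; divisible by 3, so that T disappears modulo 3. *)
Definition theta : C := (0 +i* 12)%C.

(* For a point [A / B] of the projective line, [ivec A B] is [|B|^2] times its
   imaginary part. *)
Definition ivec (v : C * C) : R := Im (v.1 * v.2^*%C).
Definition nvec (v : C * C) : R := cn v.2 ^+ 2.
Definition vapp (M : mat2 C) (v : C * C) : C * C :=
  (ma M * v.1 + mb M * v.2, mc M * v.1 + md M * v.2).
Definition base : C * C := ((0 +i* 6)%C, 1).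

Lemma vapp_mul M N v : vapp (mmul M N) v = vapp M (vapp N v).
Proof. by rewrite /vapp; congr (_, _); rewrite /=; ring. Qed.

Lemma ivec_tpow n v : ivec (vapp (ev theta (tpow n)) v) = ivec v + 12 * n%:~R * nvec v.
Proof.
rewrite ev_tpow /ivec /nvec /vapp cn_sqr; case: v => -[a a'] [b b'].
rewrite -(rmorph_int (real_complex R)) /=; ring.
Qed.

Lemma nvec_tpow n v : nvec (vapp (ev theta (tpow n)) v) = nvec v.
Proof. by rewrite ev_tpow /nvec /vapp /= mul0r add0r mul1r. Qed.

Lemma nvec_ge0 v : 0 <= nvec v. Proof. exact: sqr_ge0. Qed.

Lemma ivec_int (M : mat2 int) v : mdet M = 1 ->
  ivec (vapp (mmap intr M) v) = ivec v.
Proof.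
move=> M1; have e : mdet (mmap intr M) = 1 :> R.
  by have := congr1 (intr : int -> R) M1; rewrite /mdet /= rmorphB !rmorphM.
move: e; rewrite /mdet /ivec /vapp; case: M {M1} => a b c d; case: v => -[x x'] [y y'] /= e.
rewrite -!(rmorph_int (real_complex R)) /=.
apply: (etrans _ (mul1r _)); rewrite -[X in _ = X * _]e; ring.
Qed.

Lemma ivec_le v : `|ivec v| <= cn v.1 * cn v.2.
Proof.
have [_] := ReIm_le (v.1 * v.2^*%C); rewrite cnM => /le_trans; apply.
by rewrite (_ : cn v.2^*%C = cn v.2)//; case: (v.2) => b b'; rewrite /cn /= sqrrN.
Qed.

(** Since Im (M z) = Im z / |c z + d|^2 and |c z + d| >= |c| |Im z|, an integral matrix not fixing
    infinity sends |Im z| >= 1 into |Im z| <= 1. *)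
Lemma nvec_int (M : mat2 int) v : mdet M = 1 -> mc M <> 0 -> nvec v <= `|ivec v| ->
  `|ivec v| <= nvec (vapp (mmap intr M) v).
Proof.
move=> M1 c0 h.
have c1 : 1 <= `|(mc M)%:~R : R|.
  rewrite -intr_norm ler1z; move/eqP: c0; rewrite -normr_gt0; lia.
have e : `|(mc M)%:~R| * `|ivec v| <= cn (vapp (mmap intr M) v).2 * cn v.2.
  have := ivec_le ((vapp (mmap intr M) v).2, v.2); apply: le_trans.
  rewrite -normrM le_eqVlt; apply/orP; left; apply/eqP; congr (`|_|).
  rewrite /ivec /vapp /=; case: v {h} => -[x x'] [y y'].
  by rewrite -!(rmorph_int (real_complex R)) /=; ring.
have [I0|I0] := eqVneq (ivec v) 0; first by rewrite I0 normr0 nvec_ge0.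
have Ipos : 0 < `|ivec v| by rewrite normr_gt0.
rewrite -(ler_pM2r Ipos); apply: (@le_trans _ _ (nvec (vapp (mmap intr M) v) * nvec v)); last first.
  by rewrite ler_wpM2l ?nvec_ge0.
have e' : `|ivec v| <= cn (vapp (mmap intr M) v).2 * cn v.2.
  by apply: le_trans e; rewrite ler_peMl.
rewrite /nvec -exprMn -expr2 ler_pXn2r ?nnegrE ?mulr_ge0 ?cn_ge0//.
Qed.

Lemma norm_le_addr (x y : R) : `|y| <= `|x + y| + `|x|.
Proof. by have := ler_normB (x + y) x; rewrite addrAC subrr add0r. Qed.

(** Powers of T take 6i to height 6 + 12 n, never below 6 in modulus, and nonzero powers take the
    strip |Im z| <= 1 to |Im z| >= 11; words in X and Y that do not fix infinity bring both back
    into the strip. *)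
Lemma flat_ivec l : nf_tail l ->
  let v := vapp (ev theta (flat l)) base in
  if l is [::] then v = base else `|ivec v| <= nvec v.
Proof.
elim: l => [_|[w n] l IH] /=.
  by rewrite /vapp /base /= !mul1r !mul0r addr0 add0r.
move=> [wT w0 ln nl]; rewrite /flat /= -/(flat l) !ev_cat !vapp_mul.
rewrite (ev_noT_int _ wT); set u := vapp (ev theta (tpow n)) _.
have w1 : mdet (ev 0 w : mat2 int) = 1 := ev_det _ _.
rewrite ivec_int//; apply: nvec_int => //.
rewrite /u nvec_tpow ivec_tpow; move/(_ nl): IH; case: l ln {u nl} => [_ ->|p l ln].
  have -> : nvec base = 1 by rewrite /nvec /base cn1 expr1n.
  have -> : ivec base = 6 by rewrite /ivec /base /=; ring.
  have -> : 6 + 12 * n%:~R * 1 = (6 + 12 * n)%:~R :> R by rewrite mulr1 rmorphD rmorphM.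
  by rewrite -intr_norm ler1z; lia.
have {ln} n0 : n <> 0 by case: ln.
set v := vapp _ base => h; have {}h : `|ivec v| <= nvec v := h; have N0 := nvec_ge0 v.
have n1 : 1 <= `|n%:~R : R| by rewrite -intr_norm ler1z; move/eqP: n0; rewrite -normr_gt0; lia.
have := norm_le_addr (ivec v) (12 * n%:~R * nvec v).
rewrite [`|_ * nvec v|]normrM (ger0_norm (nvec_ge0 v)) normrM (ger0_norm (_ : 0 <= 12 :> R))//.
by have := ler_peMl N0 n1; lra.
Qed.

(** The second alternative keeps the image of 6i at distance at least 1 from 6i. It yields both the
    faithfulness of the matrices and the bounds on their entries after conjugation. *)
Lemma key w (v := vapp (ev theta w) base) : weq w [::] \/
  (cn v.2 <= cn (v.1 - base.1 * v.2)).
Proof.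
have [n [u [l [uT u0 nl we]]]] := normal_form w.
have [_ [b [e eu]] _ ub] := stab_weq uT u0.
have u1 : mdet (ev 0 u : mat2 int) = 1 := ev_det _ _.
have := flat_ivec nl; rewrite {}/v; have [_ -> _] := we.
rewrite !ev_cat !vapp_mul (ev_noT_int _ uT); case: l nl we => [_ we -> | p l nl we].
  have [/andP[/eqP n0 /eqP b0]|nb] := boolP ((n == 0) && (b == 0)).
    left; apply: (weq_trans we); rewrite n0 /= cats0; apply: ub.
    by rewrite eu b0.
  right; rewrite ev_tpow eu; set a := (-1) ^+ e; set v := vapp _ _.
  have -> : v.1 - base.1 * v.2 = (b%:~R +i* (12 * (n * a)%:~R))%C.
    rewrite /v /= -!(rmorph_int (real_complex R)) /= rmorphM /=.
    by apply/eqP; rewrite eq_complex /=; apply/andP; split; apply/eqP; ring.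
  have -> : v.2 = a%:~R by rewrite /v /= !rmorph0; ring.
  have a2 : a ^+ 2 = 1 by rewrite /a sqrr_sign.
  rewrite -(@ler_pXn2r _ 2) ?nnegrE ?cn_ge0// !cn_sqr -(rmorph_int (real_complex R)) /=.
  rewrite expr0n addr0 -rmorphXn a2.
  have -> : b%:~R ^+ 2 + (12 * (n * a)%:~R) ^+ 2 = (b ^+ 2 + 144 * n ^+ 2 * a ^+ 2)%:~R :> R.
    by rewrite !(rmorphD, rmorphM, rmorphXn) /=; ring.
  rewrite a2 ler1z mulr1; move: nb; rewrite negb_and; have := sqr_ge0 n; have := sqr_ge0 b.
  by rewrite -(sqrf_eq0 n) -(sqrf_eq0 b); lia.
move=> h; right.
set v' := vapp (mmap _ _) _.
have I' : ivec v' = ivec (vapp (ev theta (flat (p :: l))) base) by exact: ivec_int.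
have N' : nvec v' = nvec (vapp (ev theta (flat (p :: l))) base).
  rewrite /nvec /v' eu /= rmorph0 mul0r add0r cnM cn_int.
  by rewrite rmorphXn /= normrX normrN1 expr1n mul1r.
move: h; rewrite -{}I' -{}N'; move: v' => v' h.
set v := vapp _ _.
have I1 : ivec v = ivec v' + 12 * n%:~R * nvec v' := ivec_tpow _ _.
have N1 : nvec v = nvec v' := nvec_tpow _ _.
have : `|ivec v - 6 * nvec v| <= cn (v.1 - base.1 * v.2) * cn v.2.
  have := ivec_le (v.1 - base.1 * v.2, v.2); apply: le_trans.
  rewrite le_eqVlt; apply/orP; left; apply/eqP; congr (`|_|).
  rewrite /ivec /nvec cn_sqr; move: v {I1 N1} => [[x x'] [y y']] /=; lra.
(* Divided by [nvec v], the left-over height is an odd multiple of 6 plus a term of modulus at most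
   1, whence 6 - 1 = 5. *)
have : 5 * nvec v <= `|ivec v - 6 * nvec v|.
  rewrite I1 N1 (_ : _ - _ = ivec v' + 6 * (2 * n - 1)%:~R * nvec v'); last first.
    by rewrite rmorphB rmorphM /=; ring.
  have n1 : 1 <= `|(2 * n - 1)%:~R : R| by rewrite -intr_norm ler1z; lia.
  move: (2 * n - 1)%R n1 => m n1.
  have := norm_le_addr (ivec v') (6 * m%:~R * nvec v').
  rewrite [`|_ * nvec v'|]normrM (ger0_norm (nvec_ge0 v')) normrM (ger0_norm (_ : 0 <= 6 :> R))//.
  by have := ler_peMl (nvec_ge0 v') n1; lra.
rewrite /nvec; have := cn_ge0 v.2; have := cn_ge0 (v.1 - base.1 * v.2).
move: (cn v.2) (cn _) => x y y0 x0 h1 h2.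
have [-> //|xn] := eqVneq x 0.
have {}x0 : 0 < x by rewrite lt_neqAle eq_sym xn.
by rewrite -(ler_pM2r x0); nra.
Qed.
End Geometry.

Section Gauss.
Variable R : realType.
Local Notation C := R[i].

Definition gauss (z : C) := exists m n : int, z = (m%:~R +i* n%:~R)%C.

Lemma gauss_int (m : int) : gauss m%:~R.
Proof. by exists m, 0; rewrite -(rmorph_int (real_complex R)). Qed.
Lemma gauss0 : gauss 0. Proof. exact: (gauss_int 0). Qed.
Lemma gauss1 : gauss 1. Proof. exact: (gauss_int 1). Qed.
Lemma gaussD y z : gauss y -> gauss z -> gauss (y + z).
Proof.
move=> [m [n ->]] [m' [n' ->]]; exists (m + m'), (n + n').
by rewrite !rmorphD.
Qed.
Lemma gaussN y : gauss y -> gauss (- y).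
Proof. by move=> [m [n ->]]; exists (- m), (- n); rewrite !rmorphN. Qed.
Lemma gaussM y z : gauss y -> gauss z -> gauss (y * z).
Proof.
move=> [m [n ->]] [m' [n' ->]]; exists (m * m' - n * n'), (m * n' + n * m').
by rewrite !(rmorphB, rmorphD, rmorphM).
Qed.

Lemma gauss_ge1 z : gauss z -> z != 0 -> 1 <= cn z.
Proof.
move=> [m [n ->]] mn0.
have {}mn0 : ~~ ((m == 0) && (n == 0)) by move: mn0; rewrite eq_complex /= !intr_eq0.
rewrite -(@ler_pXn2r _ 2) ?nnegrE ?cn_ge0 ?ler01// cn_sqr expr1n /= -!rmorphXn -rmorphD ler1z.
by move: mn0; have := sqr_ge0 m; have := sqr_ge0 n; rewrite -(sqrf_eq0 m) -(sqrf_eq0 n); lia.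
Qed.

Definition mgauss (g : mat2 C) :=
  [/\ gauss (ma g), gauss (mb g), gauss (mc g) & gauss (md g)].

Lemma mgaussM g h : mgauss g -> mgauss h -> mgauss (mmul g h).
Proof. by move=> [????] [????]; split; apply: gaussD; exact: gaussM. Qed.
Lemma mgauss1 : mgauss mone.
Proof. split; by [exact: gauss0|exact: gauss1]. Qed.
Lemma mgaussV g : mgauss g -> mgauss (minv g).
Proof. by move=> [????]; split=> //; exact: gaussN. Qed.

End Gauss.

Section Blocks.
Variable R : realType.
Local Notation C := R[i].

(* [hmat] moves the point [base.1], which lies in the domain of discontinuity, to
   infinity. *)
Definition hmat : mat2 C := Mat2 0 (-1) 1 (- (@base R).1).

Lemma hmat_det : mdet hmat = 1. Proof. by rewrite /mdet /=; ring. Qed.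

Definition kev (w : word) : mat2 C := mmul (mmul hmat (ev (@theta R) w)) (minv hmat).

Lemma kev_cat w w' : kev (w ++ w') = mmul (kev w) (kev w').
Proof.
by rewrite /kev ev_cat !mmulA mmulKV// hmat_det.
Qed.

Lemma kev0 : kev [::] = mone.
Proof. by rewrite /kev /= mmulr1 mmulrV// hmat_det. Qed.

Lemma kev_det w : mdet (kev w) = 1.
Proof. by rewrite !mdetM mdetV hmat_det ev_det !mulr1. Qed.

Lemma kev_winv w : kev (winv w) = minv (kev w).
Proof. by rewrite /kev ev_winv !minvM minvK mmulA. Qed.

Lemma kev_inj w w' : kev w = kev w' -> ev (@theta R) w = ev (@theta R) w'.
Proof.
move=> /(congr1 (fun M => mmul (mmul (minv hmat) M) hmat)).
by rewrite /kev !mmulA mmulV ?hmat_det// !mmul1 !mmulKV// hmat_det.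
Qed.

Lemma weq_kev w w' : weq w w' -> kev w = kev w'.
Proof. by case=> _ e _; rewrite /kev e. Qed.

(** Faithfulness: by [key], a quotient of the two words that is not [weq] to the empty word would
    move the base point. Path sums thus become functions of matrices. *)
Lemma kev_weq w w' : kev w = kev w' -> weq w w'.
Proof.
move=> /kev_inj e.
have [h|] := key R (w ++ winv w').
  apply: (weq_trans (w2 := (w ++ winv w') ++ w')).
    rewrite -catA -[X in weq X _]cats0; apply: weq_cat => //.
    by apply: weq_sym; exact: weq_mulVw.
  by rewrite -[X in weq _ X]cat0s; exact: weq_cat.
rewrite ev_cat ev_winv e mmulrV ?ev_det//.
rewrite (_ : vapp mone (base R) = base R); last by rewrite /vapp !mul1r !mul0r addr0 add0r.
by rewrite -[(@base R).2]/(1 : C) mulr1 subrr cn0 cn1 ler10.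
Qed.

(** Conjugation by [hmat] turns the two sides of [key] into the entries of the first column. *)
Lemma kev_ma w : kev w <> mone -> cn (ma (kev w)) <= cn (mc (kev w)).
Proof.
move=> w1; have [/weq_kev|] := key R w; first by rewrite kev0.
set v := vapp _ _ => h.
have -> : ma (kev w) = v.2 by rewrite /v /vapp /=; ring.
by have -> : mc (kev w) = - (v.1 - (@base R).1 * v.2); [rewrite /v /vapp /=; ring|rewrite cnN].
Qed.

Lemma kev_bound w : kev w <> mone ->
  [/\ mc (kev w) != 0, cn (ma (kev w)) <= cn (mc (kev w)) &
      cn (md (kev w)) <= cn (mc (kev w))].
Proof.
move=> w1; have h := kev_ma w1; split => //.
  apply/eqP => c0; move: h; rewrite c0 cn0 => a0.
  have {a0}a0 : ma (kev w) = 0 by apply/eqP; rewrite -cn_eq0 eq_le a0 cn_ge0.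
  by have := kev_det w; rewrite /mdet a0 c0 mul0r mulr0 subr0 => /esym/eqP; rewrite oner_eq0.
have w1' : kev (winv w) <> mone.
  by rewrite kev_winv => e; apply: w1; rewrite -[kev w]minvK e minv1.
by have := kev_ma w1'; rewrite kev_winv /= cnN.
Qed.

Lemma ev_gauss w : mgauss (ev (@theta R) w).
Proof.
have g12 : gauss (@theta R) by exists 0, 12; rewrite /theta.
elim: w => [|l w IH]; first exact: mgauss1.
rewrite ev_cons; apply: mgaussM => //.
have g0 := gauss0 R; have g1 := gauss1 R; have g2 := gauss_int R 2.
by case: l => -[] []; split; rewrite //=; exact: gaussN.
Qed.

Lemma kev_gauss w : mgauss (kev w).
Proof.
have g0 := gauss0 R; have g1 := gauss1 R.
have gh : mgauss hmat.
  split; rewrite //=; [exact: gaussN|apply: gaussN; by exists 0, 6].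
by apply: mgaussM; [apply: mgaussM => //; exact: ev_gauss|exact: mgaussV].
Qed.

End Blocks.

(** * Absence of torsion in G *)

Section Torsion.
Variable R : realType.
Local Notation C := R[i].
Implicit Types g : mat2 C.

(** By Cayley-Hamilton (g - 1)^2 = 0, so the binomial expansion stops at its linear term. *)
Lemma mpow_trace2 g n : mdet g = 1 -> ma g + md g = 2 ->
  mpow g n = Mat2 (1 + n%:R * (ma g - 1)) (n%:R * mb g) (n%:R * mc g) (1 + n%:R * (md g - 1)).
Proof.
rewrite /mdet => g1 t; have e : md g = 2 - ma g by rewrite -t addrC addKr.
have e' : mb g * mc g = ma g * (2 - ma g) - 1 by rewrite -e -[X in _ = _ - X]g1; ring.
elim: n => [|n IH]; first by apply: mat2P; rewrite /= mul0r ?addr0.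
rewrite mpowS IH; apply: mat2P => /=; rewrite ?e ?mulrS.
- transitivity (ma g * (1 + n%:R * (ma g - 1)) + n%:R * (mb g * mc g)); first by ring.
  by rewrite e'; ring.
- ring.
- ring.
- transitivity (n%:R * (mb g * mc g) + (2 - ma g) * (1 + n%:R * (2 - ma g - 1))); first by ring.
  by rewrite e'; ring.
Qed.

Lemma unipotent_torsion g n : (0 < n)%N -> mdet g = 1 -> ma g + md g = 2 ->
  mpow g n = mone -> mc g = 0.
Proof.
move=> n0 g1 t; rewrite mpow_trace2// => -[_ _ /eqP + _].
by rewrite mulf_eq0 pnatr_eq0 (gtn_eqF n0) => /eqP.
Qed.

(* [v] is the eigenvector for the root [l] of the characteristic polynomial. *)
Lemma torsion_trace g n : (0 < n)%N -> mdet g = 1 -> mc g != 0 -> mpow g n = mone ->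
  Im (ma g + md g) = 0 /\ `|Re (ma g + md g)| <= 2.
Proof.
rewrite /mdet => n0 g1 c0 gn; set t := ma g + md g.
pose l := (t + sqrtc (t ^+ 2 - 4)) / 2.
have lE : l ^+ 2 = t * l - 1.
  have := sqr_sqrtc (t ^+ 2 - 4); rewrite /l; move: (sqrtc _) => s hs.
  have two : (2 : C) != 0 by rewrite pnatr_eq0.
  rewrite (_ : _ ^+ 2 = (t ^+ 2 + 2 * t * s + s ^+ 2) / 4); last by field.
  by rewrite hs; field.
have lE' : (l - md g) * (l - ma g) = mb g * mc g.
  transitivity (l ^+ 2 - t * l + ma g * md g); first by rewrite /t; ring.
  by rewrite lE -[X in _ - X - _ + _]g1; ring.
pose v : C * C := (l - md g, mc g).
have gv : vapp g v = (l * v.1, l * v.2).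
  rewrite /vapp /=; congr (_, _); last by ring.
  transitivity (ma g * (l - md g) + (l - md g) * (l - ma g)); first by rewrite lE'.
  by ring.
have vappZ h k (u : C * C) : vapp h (k * u.1, k * u.2) = (k * (vapp h u).1, k * (vapp h u).2).
  by rewrite /vapp /=; congr (_, _); ring.
have gvn m : vapp (mpow g m) v = (l ^+ m * v.1, l ^+ m * v.2).
  elim: m => [|m IH]; first by rewrite /vapp /= !mul1r !mul0r addr0 add0r.
  by rewrite mpowS vapp_mul IH vappZ gv /= exprS; congr (_, _); ring.
have ln : l ^+ n = 1.
  have := gvn n; rewrite gn /vapp /= !mul0r !mul1r add0r addr0 => -[_ /esym/eqP].
  by rewrite -subr_eq0 -[X in _ - X]mul1r -mulrBl mulf_eq0 (negPf c0) orbF subr_eq0 => /eqP.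
have l1 : cn l = 1.
  have : cn l ^+ n = 1 by rewrite -cnX ln cn1.
  by move/eqP; rewrite pexprn_eq1 ?cn_ge0// => /orP[|/eqP//]; rewrite (gtn_eqF n0).
(* The eigenvalue is a root of unity, so its inverse, the other eigenvalue, is its conjugate. *)
have tE : t = l + l^*%C.
  have ll : l * l^*%C = 1.
    by rewrite -sqr_normc -cnC l1 expr1n.
  rewrite -[LHS]mulr1 -ll mulrA (_ : t * l = l ^+ 2 + 1); last by rewrite lE subrK.
  by rewrite mulrDl mul1r expr2 -mulrA ll mulr1.
have [lr _] := ReIm_le l; move: lr; rewrite l1 tE; case: (l) => x y /= x1.
rewrite subrr; split=> //; rewrite -mulr2n normrMn; lra.
Qed.

Lemma gauss_real_trace (t : C) : gauss t -> Im t = 0 -> `|Re t| <= 2 ->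
  exists2 m : int, t = m%:~R & `|m| <= 2.
Proof.
move=> [m [n ->]] /= /eqP; rewrite intr_eq0 => /eqP -> h.
exists m; first by rewrite -(rmorph_int (real_complex R)).
by move: h; rewrite -intr_norm -[2]/(2%:~R) ler_int.
Qed.

(* Setting T = 1 reduces the matrices of all words modulo 12 to those of words in
   X and Y. *)
Lemma ev_mod12 w : let w0 := [seq l <- w | ~~ is_GT l] in
  exists g, mgauss g /\ [/\ ma (ev (@theta R) w) = (ma (ev 0 w0))%:~R + 12 * ma g,
    mb (ev (@theta R) w) = (mb (ev 0 w0))%:~R + 12 * mb g,
    mc (ev (@theta R) w) = (mc (ev 0 w0))%:~R + 12 * mc g &
    md (ev (@theta R) w) = (md (ev 0 w0))%:~R + 12 * md g].
Proof.
have g0 := gauss0 R; have g1 := gauss1 R; have g2 := gauss_int R 2.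
have gi : gauss ('i%C : C) by exists 0, 1.
have th : @theta R = 12 * 'i%C.
  by apply/eqP; rewrite eq_complex /theta; apply/andP; split; apply/eqP => /=; ring.
elim: w => [|l w [g [gg [ea eb ec ed]]]].
  by exists (Mat2 0 0 0 0); split => //; split; rewrite /= mulr0 addr0.
have gev := ev_gauss R w.
have [lT|lT] := boolP (is_GT l).
  have -> : [seq k <- l :: w | ~~ is_GT k] = [seq k <- w | ~~ is_GT k] by rewrite /= lT.
  case: l lT => -[] // b _.
  pose sg : C := if b then -1 else 1.
  have gs : gauss sg by rewrite /sg; case: (b) => //; apply: gaussN.
  case: gev gg => [h1 h2 h3 h4] [k1 k2 k3 k4].
  exists (Mat2 (ma g + sg * 'i%C * mc (ev (@theta R) w))
     (mb g + sg * 'i%C * md (ev (@theta R) w)) (mc g) (md g)); split.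
    by split=> //=; apply: gaussD => //; apply: gaussM => //; apply: gaussM.
  rewrite ev_cons; move: (ev (@theta R) w) ea eb ec ed => E ea eb ec ed.
  by rewrite /sg /lmat th; case: (b) => /=; split; rewrite ?ea ?eb ?ec ?ed; ring.
have -> : [seq k <- l :: w | ~~ is_GT k] = l :: [seq k <- w | ~~ is_GT k] by rewrite /= lT.
have lg : mgauss (lmat (@theta R) l) by case: l lT => -[] [] // _; split => //; exact: gaussN.
exists (mmul (lmat (@theta R) l) g); split; first exact: mgaussM.
rewrite !ev_cons /=; case: l lT {lg} => -[] [] // _;
  by rewrite /lmat /= ea eb ec ed !(rmorphD, rmorphM, rmorphN) /=; split; ring.
Qed.

End Torsion.

Section TorsionFree.
Variable R : realType.
Local Notation C := R[i].

Lemma mmul_self (g : mat2 C) : mdet g = 1 -> let t := ma g + md g in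
  mmul g g = Mat2 (t * ma g - 1) (t * mb g) (t * mc g) (t * md g - 1).
Proof. by rewrite /mdet => g1 /=; apply: mat2P => /=; rewrite -?[X in _ - X]g1; ring. Qed.

Lemma mmul_cube (g : mat2 C) : mdet g = 1 -> ma g + md g = 1 ->
  mmul g (mmul g g) = mopp mone.
Proof.
move=> g1 t; rewrite mmul_self// t !mul1r; move: g1; rewrite /mdet.
have e : md g = 1 - ma g by rewrite -t; ring.
rewrite e => d1; apply: mat2P; rewrite /= ?e.
- transitivity (ma g * (ma g - 1) + mb g * mc g); first by ring.
  by rewrite -[X in _ = - X]d1; ring.
- by ring.
- by ring.
- transitivity (mc g * mb g + (1 - ma g) * (- ma g)); first by ring.
  by rewrite -[X in _ = - X]d1; ring.
Qed.

Lemma neg_unipotent_torsion (g : mat2 C) n : (0 < n)%N -> mdet g = 1 ->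
  ma g + md g = -2 -> mpow g n = mone -> mc g = 0.
Proof.
move=> n0 g1 t gn; have gg := mmul_self g1; rewrite /= t in gg.
have : mc (mmul g g) = 0.
  apply: (unipotent_torsion n0).
  - by rewrite mdetM g1 mulr1.
  - by rewrite gg /= (_ : md g = -2 - ma g); [ring|rewrite -t; ring].
  - have powM k : mpow (mmul g g) k = mmul (mpow g k) (mpow g k).
      elim: k => [|k IH]; first by rewrite mmul1.
      by rewrite !mpowS IH -!mmulA; congr mmul; rewrite !mmulA -mpowS mpowSr.
    by rewrite powM gn mmul1.
by rewrite gg /= => /eqP; rewrite mulf_eq0 oppr_eq0 pnatr_eq0 => /eqP.
Qed.

Lemma kev_trace w : ma (kev R w) + md (kev R w) = ma (ev (@theta R) w) + md (ev (@theta R) w).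
Proof. by rewrite /kev /hmat /=; ring. Qed.

(** Trace -1 forces the matrix to be the identity modulo 3. Writing it as 1 + 3 g', the conditions
    on trace and determinant give 3 det g' = 1, impossible for a Gaussian integer. *)
Lemma kev_trace_neq_m1 w : ma (kev R w) + md (kev R w) <> -1.
Proof.
rewrite kev_trace => t; have [g [gg [ea eb ec ed]]] := ev_mod12 R w.
move: ea eb ec ed; set w0 := [seq l <- w | ~~ is_GT l].
have w0T : noT w0 by rewrite /noT /w0 filter_all.
have d1 : mdet (ev (@theta R) w) = 1 := ev_det _ _.
have /ev_mod3 := w0T; rewrite ev_Zp; move: (ev 0 w0) => [a b c d] /= L ea eb ec ed.
have [y [n tE]] : gauss (ma g + md g) by case: gg => *; exact: gaussD.
have t3 : a + d + 12 * y = -1.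
  have e : (a + d + 12 * y)%:~R = -1 :> R.
    have e : (a + d)%:~R + 12 * (ma g + md g) = -1 by rewrite -t ea ed rmorphD /=; ring.
    have := congr1 (@complex.Re R) e.
    rewrite tE -(rmorph_int (real_complex R)) /= !rmorphD rmorphM /= => <-; ring.
  by apply/eqP; rewrite -(eqr_int R) e.
have res (x : int) (r : int) : x%:~R = r%:~R :> 'Z_3 -> exists z, x = r + 3 * z.
  move=> /eqP; rewrite -subr_eq0 -rmorphB -dvdz_Zp// => /dvdzP[z e].
  by exists z; rewrite mulrC -e addrC subrK.
have : [/\ a%:~R = 1%:~R :> 'Z_3, b%:~R = 0%:~R :> 'Z_3, c%:~R = 0%:~R :> 'Z_3 & d%:~R = 1%:~R :> 'Z_3].
  have td : a%:~R + d%:~R = -1 :> 'Z_3.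
    rewrite -rmorphD (_ : a + d = -1 - 12 * y); last by rewrite -t3; ring.
    rewrite rmorphB rmorphM /= (_ : 12%:~R = 0 :> 'Z_3) ?mul0r ?subr0//.
    by apply/eqP; vm_compute.
  move: L td; rewrite !inE => /or4P[|||/or4P[|||/orP[]]] /eqP[-> -> -> ->] // /eqP; by vm_compute.
case=> /res[a' aE] /res[b' bE] /res[c' cE] /res[d' dE].
pose g' := Mat2 (a'%:~R + 4 * ma g) (b'%:~R + 4 * mb g) (c'%:~R + 4 * mc g) (d'%:~R + 4 * md g).
have gg' : mgauss g'.
  have g4 := gauss_int R 4; case: gg => h1 h2 h3 h4.
  by split; apply: gaussD; [exact: gauss_int|exact: gaussM|exact: gauss_int|exact: gaussM|
    exact: gauss_int|exact: gaussM|exact: gauss_int|exact: gaussM].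
have ea' : ma (ev (@theta R) w) = 1 + 3 * ma g' by rewrite ea aE rmorphD rmorphM /=; ring.
have eb' : mb (ev (@theta R) w) = 3 * mb g' by rewrite eb bE rmorphD rmorphM /=; ring.
have ec' : mc (ev (@theta R) w) = 3 * mc g' by rewrite ec cE rmorphD rmorphM /=; ring.
have ed' : md (ev (@theta R) w) = 1 + 3 * md g' by rewrite ed dE rmorphD rmorphM /=; ring.
have dg : gauss (mdet g').
  by case: gg' => h1 h2 h3 h4; apply: gaussD; [|apply: gaussN]; exact: gaussM.
have : 3 * (3 * mdet g' - 1) = 0.
  move: d1 t; rewrite /mdet ea' eb' ec' ed' => d1 t.
  transitivity ((1 + 3 * ma g') * (1 + 3 * md g') - 3 * mb g' * (3 * mc g')
    - (1 + 3 * ma g' + (1 + 3 * md g')) - 2); first by rewrite /=; ring.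
  by rewrite d1 t; ring.
move/eqP; rewrite mulf_eq0 pnatr_eq0 /= subr_eq0 => /eqP.
case: dg => p [q ->] /(congr1 (@complex.Re R)).
rewrite (_ : 3 = (3 : R)%:C%C); last by rewrite rmorph_nat.
rewrite /= mul0r subr0 => e.
have /eqP : (3 * p)%:~R = 1%:~R :> R by rewrite rmorphM.
by rewrite eqr_int; lia.
Qed.

(** The trace of a torsion element is an integer between -2 and 2. Traces 0 and 1 would produce the
    negative of the identity, whose lower left entry is 0; traces 2 and -2 are parabolic, of
    infinite order; -1 is excluded modulo 3. *)
Lemma kev_torsion_free w n : (0 < n)%N -> mpow (kev R w) n = mone -> kev R w = mone.
Proof.
move=> n0 wn; apply: contrapT => w1; have [c0 _ _] := kev_bound w1.
have d1 := kev_det R w.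
have [t1 t2] := torsion_trace n0 d1 c0 wn.
have [m mE m2] := gauss_real_trace (gaussD (let: And4 h _ _ _ := kev_gauss R w in h)
  (let: And4 _ _ _ h := kev_gauss R w in h)) t1 t2.
have ww := mmul_self d1; have w2E := kev_cat R w w; rewrite /= in ww.
have m1N : mone <> mopp mone :> mat2 C.
  by case=> /eqP; rewrite -addr_eq0 -(natrD _ 1 1) pnatr_eq0.
have nN u : kev R u <> mopp mone.
  move=> uE; have u1 : kev R u <> mone by rewrite uE; exact/nesym.
  by have [] := kev_bound u1; rewrite uE /= oppr0 eqxx.
have [m_2|[m_1|[m_0|[m_n1|m_n2]]]] :
    m = 2 \/ m = 1 \/ m = 0 \/ m = -1 \/ m = -2 by lia.
- by move/eqP: c0; apply; apply: (unipotent_torsion n0) => //; rewrite mE m_2.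
- by apply: (nN (w ++ w ++ w)); rewrite !kev_cat mmul_cube// mE m_1.
- apply: (nN (w ++ w)); rewrite w2E ww mE m_0; apply: mat2P => /=; ring.
- by apply: (@kev_trace_neq_m1 w); rewrite mE m_n1.
- by move/eqP: c0; apply; apply: (neg_unipotent_torsion n0) => //; rewrite mE m_n2.
Qed.

End TorsionFree.

(** * Homomorphisms from the cyclic covers of G *)

Definition additive_on (M : Type) (mul : M -> M -> M) (G : M -> Prop) (A : zmodType)
    (chi : M -> A) := forall g h, G g -> G h -> chi (mul g h) = chi g + chi h.

Definition periodic (A : Type) (k : nat) (f : int -> A) := forall j : int, f (j + k) = f j.

Lemma winv_cat v w : winv (v ++ w) = winv w ++ winv v.
Proof. by rewrite /winv map_cat rev_cat. Qed.

Lemma winvK : involutive winv.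
Proof. by move=> w; rewrite /winv map_rev revK (mapK linvK). Qed.

Section PeriodicLabels.
Variables (A : zmodType) (k : nat) (al be ga : int -> A).
Hypotheses (pa : periodic k al) (pb : periodic k be) (pg : periodic k ga).

Lemma periodicM (B : Type) (f : int -> B) (j m : int) : periodic k f -> f (j + k%:Z * m) = f j.
Proof.
move=> pf; have h (i : int) (n : nat) : f (i + k%:Z * n) = f i.
  elim: n => [|n IH]; first by rewrite mulr0 addr0.
  by rewrite -addn1 PoszD mulrDr mulr1 addrA pf.
case: m => n; first exact: h.
by rewrite NegzE mulrN -[in RHS](subrK (k%:Z * n.+1) j) h.
Qed.

Lemma psum_periodic w (j m : int) : psum al be ga (j + k%:Z * m) w = psum al be ga j w.
Proof.
elim: w j => [//|l w IH] j /=; rewrite addrAC IH; congr (_ + _).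
by case: l => -[] []; rewrite /lval ?[j + _ - 1]addrAC !periodicM.
Qed.

Lemma psum_dvd w w' : (k %| pos w)%Z ->
  psum al be ga 0 (w ++ w') = psum al be ga 0 w + psum al be ga 0 w'.
Proof.
by move=> /dvdzP[m e]; rewrite psum_cat e mulrC psum_periodic.
Qed.

End PeriodicLabels.

Section Subgroups.
Variable R : realType.
Local Notation C := R[i].
Implicit Types g h : mat2 C.

(* The kernel of the homomorphism to [Z/k] sending X and T to 1 and Y to 0. *)
Definition cyc_cover (k : nat) (g : mat2 C) := exists2 w, g = kev R w & (k %| pos w)%Z.

Variable k : nat.

Lemma cyc_cover1 : cyc_cover k mone.
Proof. by exists [::]; rewrite ?kev0// dvdz0. Qed.
Lemma cyc_coverM g h : cyc_cover k g -> cyc_cover k h -> cyc_cover k (mmul g h).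
Proof.
by move=> [w -> kw] [w' -> kw']; exists (w ++ w'); rewrite ?kev_cat// pos_cat rpredD.
Qed.
Lemma cyc_coverV g : cyc_cover k g -> cyc_cover k (minv g).
Proof. by move=> [w -> kw]; exists (winv w); rewrite ?kev_winv// pos_winv rpredN. Qed.
Lemma cyc_cover_det g : cyc_cover k g -> mdet g = 1.
Proof. by move=> [w -> _]; exact: kev_det. Qed.

Lemma cyc_cover_kev w : (k %| pos w)%Z -> cyc_cover k (kev R w).
Proof. by exists w. Qed.

Lemma cyc_cover_comm : cyc_cover k (kev R comm).
Proof. by apply: cyc_cover_kev; rewrite dvdz0. Qed.

Section Homomorphisms.
Variable A : zmodType.

(** Periodic labels descend to the graph with k vertices, where the words of the cover are the
    closed paths at 0. The sum is independent of the chosen word by [kev_weq]. *)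
Lemma hom_of_labels (al be ga : int -> A) (b : A) :
  periodic k al -> periodic k be -> periodic k ga -> affine b be ->
  exists2 psi : mat2 C -> A, additive_on (@mmul C) (cyc_cover k) psi &
    forall w, (k %| pos w)%Z -> psi (kev R w) = psum al be ga 0 w.
Proof.
move=> pa pb pg hb.
pose psi g := if pselect (exists2 w, g = kev R w & (k %| pos w)%Z) is left e
  then psum al be ga 0 (s2val (cid2 e)) else 0.
have psiE w : (k %| pos w)%Z -> psi (kev R w) = psum al be ga 0 w.
  move=> kw; rewrite /psi; case: pselect => [e|[]]; last by exists w.
  case: cid2 => w' /= /kev_weq[_ _ vw] _; exact/esym/(vw _ _ _ _ b).
exists psi => // _ _ [w -> kw] [w' -> kw'].
by rewrite -kev_cat !psiE// ?pos_cat ?rpredD// (psum_dvd pa pb pg).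
Qed.

Variable chi : mat2 C -> A.
Hypotheses (k0 : (0 < k)%N) (chiM : additive_on (@mmul C) (cyc_cover k) chi).

Lemma hom1 : chi mone = 0.
Proof.
have := chiM cyc_cover1 cyc_cover1; rewrite mmul1 => /eqP.
by rewrite -subr_eq subrr eq_sym => /eqP.
Qed.

Lemma homV g : cyc_cover k g -> chi (minv g) = - chi g.
Proof.
move=> kg; apply/eqP; rewrite -addr_eq0 -chiM//; last exact: cyc_coverV.
by rewrite mmulV ?hom1// (cyc_cover_det kg).
Qed.

(* Schreier transversal of [cyc_cover k]. *)
Let sec (j : int) : word := nseq `|(j %% k)%Z|%N (GX, false).

Let pos_sec j : pos (sec j) = (j %% k)%Z.
Proof.
rewrite /sec -[RHS]gez0_abs ?modz_ge0//; last by rewrite eqz_nat -lt0n.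
by elim: (absz _) => //= n ->; rewrite /lpos; lia.
Qed.

Let sec_periodic : periodic k sec.
Proof. by move=> j; rewrite /sec modzDr. Qed.

Let seg (j : int) (w : word) := sec j ++ w ++ winv (sec (j + pos w)).

Let seg_dvd j w : (k %| pos (seg j w))%Z.
Proof.
rewrite !pos_cat pos_winv !pos_sec.
rewrite [X in (_ %| X)%Z](_ : _ = (j + pos w - ((j + pos w) %% k)%Z) - (j - (j %% k)%Z)); last by ring.
have h i : (k %| i - (i %% k)%Z)%Z.
  by apply/dvdzP; exists (i %/ k)%Z; rewrite {1}(divz_eq i k) addrK.
by rewrite rpredB.
Qed.

Let seg_cat j w w' : kev R (seg j (w ++ w')) = mmul (kev R (seg j w)) (kev R (seg (j + pos w) w')).
Proof.
rewrite -kev_cat; apply: weq_kev; rewrite /seg -!catA; apply: weq_cat => //; apply: weq_cat => //.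
rewrite [X in weq _ X]catA -[X in weq X _]cat0s pos_cat addrA; apply: weq_cat => //.
by apply: weq_sym; exact: weq_mulVw.
Qed.

Let lab (l : letter) (j : int) : A := chi (kev R (seg j [:: l])).

Let lab_periodic l : periodic k (lab l).
Proof.
by move=> j; rewrite /lab /seg sec_periodic addrAC sec_periodic.
Qed.

Let chi_seg w j : chi (kev R (seg j w)) =
  psum (lab (GX, false)) (lab (GY, false)) (lab (GT, false)) j w.
Proof.
elim: w j => [|l w IH] j.
  rewrite /seg /= addr0 (weq_kev _ (weq_mulwV _)) kev0; exact: hom1.
rewrite -cat1s seg_cat chiM; try by apply: cyc_cover_kev; exact: seg_dvd.
rewrite IH [psum _ _ _ _ (_ ++ _)]/= [pos [:: l]]/= addr0; congr (_ + _).
have inv s i : chi (kev R (seg i [:: linv s])) = - lab s (i - lpos s).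
  rewrite /lab -homV; last by apply: cyc_cover_kev; exact: seg_dvd.
  rewrite -kev_winv; congr (chi (kev R _)).
  by rewrite /seg !winv_cat winvK /= !addr0 subrK lpos_inv -catA.
case: l => -[] []; rewrite /lval //.
- exact: (inv (GX, false)).
- by rewrite -[j in RHS]subr0; exact: (inv (GY, false)).
- exact: (inv (GT, false)).
Qed.

(** Converse of [hom_of_labels]: the labels are the values on the Schreier generators. Going once
    around the k vertices returns [be] to its start after k equal increments, hence k b = 0. *)
Lemma schreier : exists (al be ga : int -> A) (b : A),
  [/\ periodic k al, periodic k be, periodic k ga & affine b be] /\
  [/\ b *~ k = 0, b = chi (kev R comm) &
      forall w, (k %| pos w)%Z -> chi (kev R w) = psum al be ga 0 w].
Proof.
set al := lab (GX, false); set be := lab (GY, false); set ga := lab (GT, false).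
have valE w : (k %| pos w)%Z -> chi (kev R w) = psum al be ga 0 w.
  move=> kw; rewrite -chi_seg /seg add0r.
  have s0 i : (k %| i)%Z -> sec i = [::].
    by move=> /dvdz_mod0P ki; rewrite /sec ki.
  by rewrite !s0 ?dvdz0// cats0.
have valc j : psum al be ga j comm = be (j + 1) - be j.
  rewrite /= /lval /lpos /= !addr0 addrK.
  by rewrite addrCA addNKr.
(* The relation with T: the commutator is read at vertex j on one side and at j + 1 on the other. *)
have step j : be (j + 1 + 1) - be (j + 1) = be (j + 1) - be j.
  have e : kev R (comm ++ tpow 1) = kev R (tpow 1 ++ comm).
    by apply: weq_kev; exact: stab_commute.
  have : chi (kev R (seg j (tpow 1 ++ comm))) = chi (kev R (seg j (comm ++ tpow 1))).
    rewrite /seg !pos_cat [pos (tpow 1) + _]addrC !kev_cat.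
    by move: e; rewrite !kev_cat => <-.
  by rewrite !chi_seg !psum_cat !valc addr0 [in RHS]addrC => /addrI.
have const j : be (j + 1) - be j = be 1 - be 0.
  have up (n : nat) i : be (i + n%:Z + 1) - be (i + n%:Z) = be (i + 1) - be i.
    elim: n => [|n IH]; first by rewrite addr0.
    by rewrite -addn1 PoszD addrA step.
  case: j => n; first by have := up n 0; rewrite !add0r.
  have := up n.+1 (Negz n); by rewrite NegzE addNr add0r => <-.
have hb : affine (be 1 - be 0) be by move=> j; rewrite -(const j) addrCA subrr addr0.
have bek (n : nat) : be n = be 0 + (be 1 - be 0) *+ n.
  elim: n => [|n IH]; first by rewrite addr0.
  by rewrite -addn1 PoszD hb IH -addrA mulrnDr.
exists al, be, ga, (be 1 - be 0); split; first by split => //; exact: lab_periodic.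
split => //.
- have bk : be k = be 0 by have := lab_periodic (GY, false) 0; rewrite add0r.
  by have := bek k; rewrite bk -{1}[be 0]addr0 => /addrI/esym.
- by rewrite valE ?dvdz0// valc.
Qed.

End Homomorphisms.
End Subgroups.

Section Invariant.
Variable R : realType.
Local Notation C := R[i].

(* The class of [comm] in the abelianization of the [k]-fold cover is torsion of order [k]. *)
Lemma int_hom_comm k (psi : mat2 C -> int) : (0 < k)%N ->
  additive_on (@mmul C) (@cyc_cover R k) psi -> psi (kev R comm) = 0.
Proof.
move=> k0 /(schreier k0)[al [be [ga [b [_ [bk <- _]]]]]].
by move/eqP: bk; rewrite mulrzz mulf_eq0 eqz_nat (gtn_eqF k0) orbF => /eqP.
Qed.

Lemma mod_hom_comm k : prime k -> exists2 chi : mat2 C -> 'Z_k,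
  additive_on (@mmul C) (@cyc_cover R k) chi & chi (kev R comm) = 1.
Proof.
move=> pk; have k1 := prime_gt1 pk.
(* The label j on the loop Y at j has increment 1, and is periodic because it is read modulo k. *)
have [||||chi chiM chiE] := @hom_of_labels R k 'Z_k (fun=> 0) (fun j => j%:~R) (fun=> 0) 1.
- by [].
- by move=> j; rewrite rmorphD /= -pmulrn pchar_Zp// addr0.
- by [].
- by move=> j; rewrite rmorphD.
by exists chi => //; rewrite chiE ?dvdz0// (@psum_comm _ _ _ _ 1)// => j; rewrite rmorphD.
Qed.

Lemma psum_map (A B : zmodType) (f : {additive A -> B}) (al be ga : int -> A) j w :
  f (psum al be ga j w) = psum (f \o al) (f \o be) (f \o ga) j w.
Proof.
elim: w j => [|l w IH] j /=; rewrite ?raddf0// raddfD IH; congr (_ + _).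
by case: l => -[] []; rewrite /lval ?raddfN.
Qed.

(** In Z/q the equation k b = 0 kills b, so [be] is constant up to no increment at all, and any
    integer representatives of the labels again satisfy the relation. *)
Lemma lift_hom k q (chi : mat2 C -> 'Z_q) : prime k -> prime q -> k != q ->
  additive_on (@mmul C) (@cyc_cover R k) chi ->
  exists2 psi : mat2 C -> int, additive_on (@mmul C) (@cyc_cover R k) psi &
    forall g, cyc_cover k g -> (psi g)%:~R = chi g.
Proof.
move=> pk pq kq /(schreier (prime_gt0 pk))[al [be [ga [b [[pa pb pg hb] [bk _ chiE]]]]]].
have b0 : b = 0.
  have ku : (k%:R : 'Z_q) \is a GRing.unit.
    by rewrite unitZpE ?prime_gt1// coprime_sym prime_coprime// dvdn_prime2.
  by apply: (mulrI ku); rewrite mulr0 mulr_natl -[RHS]bk.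
pose li (x : 'Z_q) : int := (x : nat)%:Z.
have liK x : (li x)%:~R = x by rewrite /li -pmulrn natr_Zp.
have [||||psi psiM psiE] := @hom_of_labels R k int (li \o al) (li \o be) (li \o ga) 0.
- by move=> j /=; rewrite pa.
- by move=> j /=; rewrite pb.
- by move=> j /=; rewrite pg.
- by move=> j /=; rewrite hb b0 !addr0.
exists psi => // _ [w -> kw]; rewrite psiE// chiE// (psum_map (intr : {additive int -> 'Z_q})).
by congr psum; apply/funext => j /=; rewrite liK.
Qed.

End Invariant.

(** * Ping-pong and free products *)

Section Placement.
Variable R : realType.
Local Notation C := R[i].
Implicit Types (g h : mat2 C) (x : R) (z : C).

(* The conjugate of [g] by [z -> x z + z0]. *)
Definition place x z0 g : mat2 C := let l : C := x%:C%C in Mat2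
  (ma g + z0 * mc g / l) (l * mb g + z0 * (md g - ma g) - z0 ^+ 2 * mc g / l)
  (mc g / l) (md g - z0 * mc g / l).

Lemma placeM x z0 g h : x != 0 ->
  place x z0 (mmul g h) = mmul (place x z0 g) (place x z0 h).
Proof.
move=> x0; have l0 : x%:C%C != 0 :> C by rewrite (inj_eq (@complexI R) x 0).
by apply: mat2P => /=; field.
Qed.

Lemma place1 x z0 : place x z0 mone = mone.
Proof. by apply: mat2P => /=; ring. Qed.

Lemma placeV x z0 g : place x z0 (minv g) = minv (place x z0 g).
Proof. by apply: mat2P => /=; ring. Qed.

Lemma place_det x z0 g : x != 0 -> mdet (place x z0 g) = mdet g.
Proof.
move=> x0; have l0 : x%:C%C != 0 :> C by rewrite (inj_eq (@complexI R) x 0).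
by rewrite /mdet /=; field.
Qed.

Lemma place_eq1 x z0 g : x != 0 -> place x z0 g = mone -> g = mone.
Proof.
move=> x0 [ha hb hc hd]; have l0 : x%:C%C != 0 :> C by rewrite (inj_eq (@complexI R) x 0).
have c0 : mc g = 0.
  by move/eqP: hc; rewrite mulf_eq0 invr_eq0 (negPf l0) orbF => /eqP.
move: ha hb hd; rewrite c0 !mulr0 !mul0r addr0 !subr0 => a1 + d1.
rewrite a1 d1 subrr mulr0 addr0 => /eqP; rewrite mulf_eq0 (negPf l0) => /eqP b0.
by apply: mat2P.
Qed.

Lemma place_pow x z0 g n : x != 0 -> place x z0 (mpow g n) = mpow (place x z0 g) n.
Proof. by move=> x0; elim: n => [|n IH]; rewrite ?place1// !mpowS placeM// IH. Qed.

Lemma mb_le g : mdet g = 1 -> 1 <= cn (mc g) -> cn (ma g) <= cn (mc g) ->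
  cn (md g) <= cn (mc g) -> cn (mb g) <= 2 * cn (mc g).
Proof.
move=> g1 c1 ac dc; have c0 : 0 < cn (mc g) by apply: lt_le_trans c1.
rewrite -(ler_pM2r c0) -cnM (_ : mb g * mc g = ma g * md g - 1); last by rewrite -g1 /mdet; ring.
have := cnD (ma g * md g) (- 1); rewrite cnN cn1 cnM.
by have := cn_ge0 (ma g); have := cn_ge0 (md g); nra.
Qed.

(* [(A, B)] is the first column of a matrix, so that [A / B] is the image of infinity. *)
Lemma place_first x z0 g (A B : C) : 0 < x -> x <= 8^-1 -> mdet g = 1 -> 1 <= cn (mc g) ->
  cn (ma g) <= cn (mc g) -> cn (md g) <= cn (mc g) ->
  (A = 1 /\ B = 0) \/ (B != 0 /\ 3 / 4 * cn B <= cn (A - z0 * B)) ->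
  let A' := ma (place x z0 g) * A + mb (place x z0 g) * B in
  let B' := mc (place x z0 g) * A + md (place x z0 g) * B in
  cn (A' - z0 * B') <= cn B' / 4 /\
  (if B == 0 then 1 else cn B) * (cn (mc g) / (4 * x)) <= cn B'.
Proof.
move=> x0 x8 g1 c1 ac dc AB A' B'.
have l0 : x%:C%C != 0 :> C by rewrite (inj_eq (@complexI R) x 0) gt_eqF.
have cl : cn x%:C%C = x by rewrite cnr gtr0_norm.
have xV : 8 <= x^-1 by rewrite -[8]invrK lef_pV2 ?posrE ?invr_gt0.
have E1 : B' = mc g / x%:C%C * (A - z0 * B) + md g * B by rewrite /B' /=; field.
have E2 : A' - z0 * B' = ma g * (A - z0 * B) + x%:C%C * mb g * B.
  by rewrite /A' /B' /=; field.
have bc := mb_le g1 c1 ac dc.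
case: AB => [[A1 B0]|[Bn h]].
  rewrite E2 E1 A1 B0 eqxx !mulr0 subr0 !addr0 !mulr1 cnM cnV cl mul1r invfM.
  have := ler_wpM2l (le_trans ler01 c1) xV; split; first by lra.
  rewrite mulrCA mulrA; have := cn_ge0 (mc g); nra.
set W := A - z0 * B in h E1 E2.
have w0 := cn_ge0 W; have b0 := cn_ge0 B; have c0 := cn_ge0 (mc g).
have F1 : cn (mc g) * (cn W / x - cn B) <= cn B'.
  rewrite E1; have := cnB (mc g / x%:C%C * W) (md g * B).
  rewrite !cnM cnV cl => /(le_trans _); apply.
  rewrite mulrBr mulrA [_ * cn W / x]mulrAC lerB// ler_wpM2r//.
have F2 : cn (A' - z0 * B') <= cn (mc g) * (cn W + cn B / 4).
  rewrite E2; apply: (le_trans (cnD _ _)); rewrite !cnM cl.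
  have : x * cn (mb g) * cn B <= 8^-1 * (2 * cn (mc g)) * cn B.
    by rewrite ler_wpM2r// ler_pM ?cn_ge0 ?(ltW x0).
  have := ler_wpM2r w0 ac.
  by lra.
(* From |W| >= 3/4 |B| and 1/x >= 8, the difference |W|/x - |B| is at least 4 |W| + |B| and at least
   |B| / (4 x): the first gives the disc of radius 1/4, the second the growth of the denominator. *)
have F3 : 8 * cn W <= cn W / x by rewrite mulrC ler_wpM2l.
split.
  apply: (le_trans F2); rewrite ler_pdivlMr//; apply: le_trans F1.
  rewrite -mulrA ler_wpM2l//; lra.
rewrite (negPf Bn); apply: le_trans F1; rewrite mulrCA ler_wpM2l//.
have F4 : 3 / 4 * cn B / x <= cn W / x by rewrite ler_wpM2r// invr_ge0 ltW.
have F5 : 8 * cn B <= cn B / x by rewrite mulrC ler_wpM2l.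
by rewrite invfM; lra.
Qed.

End Placement.

Section FreeProduct.
Variables (R : realType) (p : nat -> nat).
Local Notation C := R[i].
Implicit Types (g h : mat2 C) (lam : nat -> R).

Definition syllable := (nat * mat2 C)%type.
Implicit Types (x y : syllable) (w : seq syllable).

Notation block n := (@cyc_cover R (p n)).

Definition sev lam x : mat2 C := place (lam x.1) x.1%:R x.2.
Definition tev lam w : mat2 C := foldr (fun x M => mmul (sev lam x) M) mone w.

(* The factors with [lam n = 0] are absent. *)
Definition scaling lam := forall n, 0 <= lam n <= (8 * n.+1%:R)^-1.

Fixpoint legal lam w : Prop :=
  if w is x :: w' then [/\ 0 < lam x.1, block x.1 x.2 & legal lam w'] else True.

Fixpoint alternates w : Prop :=
  if w is x :: w' then
    [/\ x.2 <> mone, (if w' is y :: _ then x.1 <> y.1 else True) & alternates w']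
  else True.

(** A lower bound for the factor by which a syllable enlarges the lower left entry in an alternating
    word; it blows up as the scale tends to 0. *)
Definition weight lam x : R := cn (mc x.2) / (4 * lam x.1).

Lemma tev_cat lam w w' : tev lam (w ++ w') = mmul (tev lam w) (tev lam w').
Proof. by elim: w => [|x w IH] /=; rewrite ?mmul1// IH mmulA. Qed.

Lemma legal_cat lam w w' : legal lam (w ++ w') <-> legal lam w /\ legal lam w'.
Proof.
elim: w => [|x w IH] /=; first by split=> [|[]].
by split=> [[? ? /IH[]]|[[? ? ?] ?]] //; split => //; apply/IH.
Qed.

Definition tinv w : seq syllable := rev [seq (x.1, minv x.2) | x <- w].

Lemma tinv_cons x w : tinv (x :: w) = tinv w ++ [:: (x.1, minv x.2)].
Proof. by rewrite /tinv /= rev_cons cats1. Qed.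

Lemma legal_tinv lam w : legal lam w -> legal lam (tinv w).
Proof.
elim: w => [//|x w IH] [l0 bx lw]; rewrite tinv_cons; apply/legal_cat; split; first exact: IH.
by split => //; exact: cyc_coverV.
Qed.

Lemma tev_tinv lam w : tev lam (tinv w) = minv (tev lam w).
Proof.
elim: w => [|x w IH]; first by rewrite minv1.
by rewrite tinv_cons tev_cat IH [tev _ [:: _]]/= mmulr1 minvM /sev placeV.
Qed.

Lemma sev_det lam x : 0 < lam x.1 -> block x.1 x.2 -> mdet (sev lam x) = 1.
Proof. by move=> l0 /cyc_cover_det; rewrite /sev place_det ?gt_eqF. Qed.

Lemma tev_det lam w : legal lam w -> mdet (tev lam w) = 1.
Proof.
elim: w => [_|x w IH] /=; first exact: mdet1.
by move=> [l0 bx /IH e]; rewrite mdetM e mulr1 sev_det.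
Qed.

Lemma block_bound n g : block n g -> g <> mone ->
  [/\ 1 <= cn (mc g), cn (ma g) <= cn (mc g) & cn (md g) <= cn (mc g)].
Proof.
move=> [w -> _] w1; have [c0 a1 d1] := kev_bound w1; split => //.
by apply: gauss_ge1 => //; case: (kev_gauss R w).
Qed.

Section Growth.
Variable lam : nat -> R.
Hypothesis hlam : scaling lam.

Lemma scaling_le8 n : lam n <= 8^-1.
Proof.
have /andP[_ /le_trans] := hlam n; apply; rewrite lef_pV2 ?posrE ?mulr_gt0//.
by rewrite ler_peMr// ler1n.
Qed.

Lemma weight_ge2 x : 0 < lam x.1 -> block x.1 x.2 -> x.2 <> mone -> 2 <= weight lam x.
Proof.
move=> l0 bx x1; have [c1 _ _] := block_bound bx x1.
rewrite /weight ler_pdivlMr ?mulr_gt0//; have := scaling_le8 x.1; lra.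
Qed.

(** Ping-pong with discs of radius 1/4 about the integers: a point in the disc of one index is at
    distance at least 3/4 from every other integer, as [place_first] requires. *)
Lemma growth x w : legal lam (x :: w) -> alternates (x :: w) ->
  let M := tev lam (x :: w) in
  [/\ cn (ma M - x.1%:R * mc M) <= cn (mc M) / 4,
      \prod_(y <- x :: w) weight lam y <= cn (mc M) & 0 < cn (mc M)].
Proof.
elim: w x => [|y w IH] x [l0 bx lw] [x1 xy aw].
  have [c1 ca cd] := block_bound bx x1.
  have := @place_first R _ x.1%:R _ 1 0 l0 (scaling_le8 _) (cyc_cover_det bx) c1 ca cd (or_introl (conj erefl erefl)).
  cbv zeta; rewrite eqxx mul1r -/(weight lam x) => -[h1 h2].
  rewrite big_cons big_nil mulr1; split; [exact: h1|exact: h2|].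
  by apply: lt_le_trans h2; apply: lt_le_trans (weight_ge2 l0 bx x1).
have [h1 h2 h3] := IH y lw aw; move: h1 h2 h3.
rewrite [tev lam (x :: _)]/= -/(tev lam (y :: w)); set M := tev lam (y :: w) => h1 h2 h3.
have [c1 ca cd] := block_bound bx x1.
have Mn : mc M != 0 by rewrite -cn_gt0.
have sep : 3 / 4 * cn (mc M) <= cn (ma M - x.1%:R * mc M).
  have d1 : 1 <= cn (y.1%:R - x.1%:R : C).
    have -> : y.1%:R - x.1%:R = (y.1%:Z - x.1%:Z)%:~R :> C by rewrite rmorphB.
    by rewrite cn_int -intr_norm ler1z; move: xy; lia.
  have := cnD (ma M - x.1%:R * mc M) (- (ma M - y.1%:R * mc M)).
  rewrite cnN (_ : _ - (ma M - _) = (y.1%:R - x.1%:R) * mc M); last by ring.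
  by rewrite cnM; have := ler_wpM2r (cn_ge0 (mc M)) d1; lra.
have := place_first l0 (scaling_le8 _) (cyc_cover_det bx) c1 ca cd (or_intror (conj Mn sep)).
cbv zeta; rewrite (negPf Mn) -/(weight lam x) => -[k1 k2].
have wx := weight_ge2 l0 bx x1; split; first exact: k1.
  rewrite big_cons; apply: le_trans k2; rewrite mulrC.
  by rewrite ler_wpM2r//; apply: le_trans wx.
by apply: lt_le_trans k2; rewrite mulr_gt0//; apply: lt_le_trans wx.
Qed.

Lemma alternates_mc w : legal lam w -> alternates w -> w <> [::] -> 2 <= cn (mc (tev lam w)).
Proof.
case: w => // x w lw aw _; have [_ h _] := growth lw aw; apply: le_trans h.
elim: w x lw aw => [|y w IH] x [l0 bx lw] [x1 _ aw].
  by rewrite big_cons big_nil mulr1 weight_ge2.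
have wx := weight_ge2 l0 bx x1; rewrite big_cons.
by have := IH _ lw aw; set P := \prod_(_ <- _) _ => hP; nra.
Qed.

End Growth.

Definition tsum (A : zmodType) (chi : nat -> mat2 C -> A) w : A :=
  foldr (fun x s => chi x.1 x.2 + s) 0 w.

Lemma tsum_cat (A : zmodType) (chi : nat -> mat2 C -> A) w w' :
  tsum chi (w ++ w') = tsum chi w + tsum chi w'.
Proof. by elim: w => [|x w IH] /=; rewrite ?add0r// IH addrA. Qed.

(** Stating invariance of [tsum] for all families at once shows later that it depends only on the
    isometry; the bound on the size serves the induction for torsion. *)
Lemma reduce lam w : legal lam w -> exists w',
  [/\ legal lam w', alternates w', tev lam w' = tev lam w, (size w' <= size w)%N &
   forall (A : zmodType) (chi : nat -> mat2 C -> A),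
    (forall n, 0 < lam n -> additive_on (@mmul C) (block n) (chi n)) ->
    tsum chi w' = tsum chi w].
Proof.
elim: w => [_|x w IH]; first by exists [::].
move=> [l0 bx /IH[w' [lw aw ew sw hw]]].
have [x1|x1] := pselect (x.2 = mone).
  exists w'; split=> //.
  - by rewrite /= ew /sev x1 place1 mmul1.
  - exact: leq_trans sw _.
  - by move=> A chi hchi; rewrite hw//= x1 (hom1 (hchi _ l0)) add0r.
case: w' lw aw ew sw hw => [|y w'] lw aw ew sw hw.
  exists [:: x]; split => //; first by rewrite /= -ew.
  by move=> A chi hchi /=; rewrite -hw.
have [xy|xy] := eqVneq x.1 y.1; last first.
  exists [:: x, y & w']; split => //; first by split => //; exact/eqP.
    exact: (congr1 (mmul (sev lam x)) ew).
  by move=> A chi hchi; exact: (congr1 (+%R (chi x.1 x.2)) (hw A chi hchi)).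
case: lw => ly by_ lw; case: aw => y1 yw aw.
have by' : block x.1 y.2 by rewrite xy.
have bxy := cyc_coverM bx by'.
have exy : sev lam (x.1, mmul x.2 y.2) = mmul (sev lam x) (sev lam y).
  by rewrite /sev placeM ?gt_eqF// -xy.
have exw : mmul (sev lam (x.1, mmul x.2 y.2)) (tev lam w') = tev lam (x :: w).
  by rewrite exy -mmulA; exact: (congr1 (mmul (sev lam x)) ew).
have [z1|z1] := pselect (mmul x.2 y.2 = mone).
  exists w'; split => //.
  - by rewrite -exw z1 /sev place1 mmul1.
  - by rewrite (leq_trans _ (leqW sw))//= leqW.
  - move=> A chi hchi; rewrite [RHS]/= -hw//= -xy addrA -(hchi _ l0)// z1.
    by rewrite (hom1 (hchi _ l0)) add0r.
exists ((x.1, mmul x.2 y.2) :: w'); split => //.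
- by split=> //=; case: (w') yw => // z w''; rewrite xy.
- exact: leqW.
- by move=> A chi hchi; rewrite [RHS]/= -hw//= -xy addrA -(hchi _ l0).
Qed.

End FreeProduct.

(** * The group generated by the scaled factors *)

Section Gamma.
Variables (R : realType) (p : nat -> nat) (lam : nat -> R).
Hypothesis hlam : scaling lam.
Local Notation C := R[i].
Local Notation block n := (@cyc_cover R (p n)).
Local Notation legal := (legal p lam).
Local Notation tev := (tev lam).
Implicit Types (w : seq (syllable R)).

Definition gamma : set (isom R) := [set f | exists2 w, legal w & f = to_isom (tev w)].

Lemma gamma1 : gamma 1%g.
Proof. by exists [::]; rewrite ?to_isom1. Qed.

Lemma gammaM f g : gamma f -> gamma g -> gamma (f * g)%g.
Proof.
move=> [w lw ->] [w' lw' ->]; exists (w ++ w'); first exact/legal_cat.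
by rewrite tev_cat to_isomM// (tev_det (p := p)).
Qed.

Lemma gammaV f : gamma f -> gamma f^-1%g.
Proof.
move=> [w lw ->]; exists (tinv w); first exact: legal_tinv.
by rewrite tev_tinv to_isomV// (tev_det (p := p)).
Qed.

Lemma gamma_subgroup : is_subgroup gamma.
Proof.
split; first exact: gamma1.
by move=> f g fG gG; apply: gammaM => //; exact: gammaV.
Qed.

Lemma tev_neq1 w : legal w -> alternates w -> w <> [::] ->
  ln 2 <= mdist (origin R) (to_isom (tev w) (origin R)).
Proof.
move=> lw aw wn; apply: mdist_ge_mc; first exact: (tev_det lw).
exact: (alternates_mc hlam lw aw wn).
Qed.

Lemma gamma_discontinuous f : gamma f -> f <> 1%g -> ln 2 <= mdist (origin R) (f (origin R)).
Proof.
move=> [w /reduce[w' [lw' aw' <- _ _]] ->] f1; apply: tev_neq1 => //.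
by move=> w0; apply: f1; rewrite w0 to_isom1.
Qed.

Lemma gamma_discrete : discrete gamma.
Proof.
move=> f fG; split; first exact/mem_set.
have l2 : 0 < ln 2 :> R by rewrite ln_gt0 ?ltr1n.
exists [set g : isom R | mdist (f (origin R)) (g (origin R)) < ln 2]; first exact: nbhs_isom_eval.
apply/seteqP; split=> g /=; last by move=> ->; rewrite mdistxx.
move=> [fg gG]; apply: contrapT => gf.
have := gamma_discontinuous (gammaM (gammaV fG) gG).
rewrite leNgt -(isom_mdist f) [X in mdist _ X](_ : _ = g (origin R)); last by rewrite /= isom_invK.
move=> h.
suff : ~~ (mdist (f (origin R)) (g (origin R)) < ln 2) by rewrite fg.
apply: h => /(congr1 (fun u => f * u)%g); rewrite mulgA mulgV mul1g mulg1.
exact: gf.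
Qed.

(** The negative of the identity is ruled out because nonempty alternating words move [origin].
    Torsion among isometries thus reduces to torsion among matrices. *)
Lemma to_isom_tev_inj1 w : legal w -> to_isom (tev w) = 1%g -> tev w = mone.
Proof.
move=> /reduce[w' [lw' aw' <- _ _]] w1.
have [->//|wn] := pselect (w' = [::]).
by have := tev_neq1 lw' aw' wn; rewrite w1 mdistxx leNgt ln_gt0// ltr1n.
Qed.

Lemma to_isom_tev_eq1 w : legal w -> to_isom (tev w) = 1%g ->
  forall (A : zmodType) (chi : nat -> mat2 C -> A),
  (forall n, 0 < lam n -> additive_on (@mmul C) (block n) (chi n)) -> tsum chi w = 0.
Proof.
move=> /reduce[w' [lw' aw' <- _ sw']] w1 A chi hchi; rewrite -(sw' _ _ hchi).
have [->//|wn] := pselect (w' = [::]).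
have := tev_neq1 lw' aw' wn; rewrite w1 mdistxx leNgt ln_gt0// ltr1n//.
Qed.

(** Torsion in a free product is conjugate into a factor. If the first and last syllables have
    different indices, all powers alternate and are nontrivial; otherwise conjugation shortens the
    word, down to a single syllable. *)
Lemma tev_torsion w n : (0 < n)%N -> legal w -> mpow (tev w) n = mone -> tev w = mone.
Proof.
move=> n0; have [m] := ubnP (size w); elim: m w => // m IH w wm /reduce[w' [lw aw <- sw _]] wn.
have {sw wm}wm : (size w' <= m)%N by rewrite -ltnS (leq_ltn_trans sw wm).
case: w' lw aw wn wm => [//|x w'] lw aw wn wm.
have powM k : mpow (tev (x :: w')) k = tev (flatten (nseq k (x :: w'))).
  by elim: k => [//|k IHk]; rewrite mpowS IHk -tev_cat.
case/lastP: w' lw aw wn powM wm => [|r y] lw aw wn powM wm.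
  case: lw wn => l0 bx _; rewrite [tev _]mmulr1 /sev -place_pow ?gt_eqF//.
  move/(place_eq1 (lt0r_neq0 l0)) => xn; have [u xE _] := bx.
  by move: xn; rewrite xE => /(kev_torsion_free n0) ->; rewrite place1.
have lxry : legal (x :: r) /\ legal [:: y].
  by apply/legal_cat; rewrite cats1.
have [lxr [ly by_ _]] := lxry; have [lx bx lr] := lxr.
have [xy|xy] := eqVneq x.1 y.1; last first.
  have powA k : legal (flatten (nseq k (x :: rcons r y))) /\
      alternates (flatten (nseq k (x :: rcons r y))).
    elim: k => [//|k [lk ak]]; split; first exact/legal_cat.
    have h u v z : alternates (rcons u z) -> alternates v ->
        (if v is t :: _ then z.1 <> t.1 else True) -> alternates (rcons u z ++ v).
      elim: u => [|t u IHu]; first by case: v => [|t v] //= [z1 _ _] av zt.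
      rewrite rcons_cons => -[t1 tu au] av zt; split => //; last exact: IHu.
      by case: u tu {IHu au}.
    change (alternates (rcons (x :: r) y ++ flatten (nseq k (x :: rcons r y)))).
    apply: h => //.
    by case: k {lk ak} => //= k; move/eqP: xy; exact/nesym.
  have [ln an] := powA n; have wn0 : flatten (nseq n (x :: rcons r y)) <> [::] by case: (n) n0.
  have := alternates_mc hlam ln an wn0; rewrite -powM wn [mc _]/= cn0.
  by rewrite lern0.
(* Conjugating by the first syllable merges it with the last one. *)
have l' : legal (rcons r (y.1, mmul y.2 x.2)).
  rewrite -cats1; apply/legal_cat; split => //; split => //=.
  by apply: cyc_coverM => //; rewrite -xy.
have e : tev (x :: rcons r y) =
    mmul (mmul (sev lam x) (tev (rcons r (y.1, mmul y.2 x.2)))) (minv (sev lam x)).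
  have tev1 z : tev [:: z] = sev lam z by exact: mmulr1.
  have yx : sev lam (y.1, mmul y.2 x.2) = mmul (sev lam y) (sev lam x).
    by rewrite /sev placeM ?gt_eqF// -xy.
  rewrite -[LHS]/(mmul (sev lam x) (tev (rcons r y))) -!cats1 !tev_cat !tev1 yx.
  by rewrite !mmulA mmulK// (sev_det lx bx).
have sx := sev_det lx bx.
have : tev (rcons r (y.1, mmul y.2 x.2)) = mone.
  apply: IH => //; first by move: wm; rewrite /= !size_rcons.
  move: wn; rewrite e mpow_conj// => /(congr1 (fun M => mmul (mmul (minv (sev lam x)) M) (sev lam x))).
  by rewrite !mmulA mmulV// mmul1 mmulKV// mmulr1 mmulV.
by rewrite e => ->; rewrite mmulr1 mmulrV.
Qed.

Lemma gamma_torsion_free : torsion_free gamma.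
Proof.
move=> _ n [w lw ->] n0; rewrite -to_isomX ?(tev_det lw)// => wn.
have powM k : mpow (tev w) k = tev (flatten (nseq k w)) /\ legal (flatten (nseq k w)).
  elim: k => [//|k [IHk lk]]; rewrite mpowS IHk -tev_cat; split => //.
  exact/legal_cat.
rewrite (tev_torsion n0 lw) ?to_isom1//.
by have [e ln] := powM n; rewrite e in wn *; exact: to_isom_tev_inj1.
Qed.

Definition Gamma : D3 R := MkD3 gamma_subgroup gamma_torsion_free gamma_discrete.

Notation hom_on A f := (additive_on (fun g h : isom R => (g * h)%g) gamma (f : isom R -> A)).

(** The universal property of the free product for abelian targets: compatible choices on the
    factors add up along words. *)
Lemma gamma_hom (A : zmodType) (chi : nat -> mat2 C -> A) :
  (forall n, 0 < lam n -> additive_on (@mmul C) (block n) (chi n)) ->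
  exists2 f : isom R -> A, hom_on A f &
    forall w, legal w -> f (to_isom (tev w)) = tsum chi w.
Proof.
move=> hchi.
pose f g := if pselect (exists2 w, legal w & g = to_isom (tev w)) is left e
  then tsum chi (s2val (cid2 e)) else 0.
have tsum_inv w : legal w -> tsum chi (tinv w) = - tsum chi w.
  elim: w => [|x w IH]; first by rewrite oppr0.
  move=> [l0 bx lw]; rewrite tinv_cons tsum_cat IH//= addr0.
  by rewrite (homV (hchi _ l0))// opprD addrC.
have fE w : legal w -> f (to_isom (tev w)) = tsum chi w.
  move=> lw; rewrite /f; case: pselect => [e|[]]; last by exists w.
  case: cid2 => w' /= lw' ww'.
  have lww : legal (w' ++ tinv w) by apply/legal_cat; split => //; exact: legal_tinv.
  have : tsum chi (w' ++ tinv w) = 0.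
    apply: (to_isom_tev_eq1 lww) hchi.
    by rewrite tev_cat tev_tinv to_isomM ?mdetV ?(tev_det (p := p))// to_isomV ?(tev_det lw)// -ww' mulgV.
  by rewrite tsum_cat tsum_inv// => /eqP; rewrite subr_eq0 => /eqP.
exists f => // _ _ [w lw ->] [w' lw' ->].
rewrite -to_isomM ?(tev_det (p := p))// -tev_cat !fE ?tsum_cat//.
exact/legal_cat.
Qed.

Lemma gamma_place n g : 0 < lam n -> block n g -> gamma (to_isom (place (lam n) n%:R g)).
Proof.
move=> l0 bg; exists [:: (n, g)] => //.
by rewrite [tev _]mmulr1.
Qed.

Lemma hom_on_place (A : zmodType) (f : isom R -> A) n : 0 < lam n -> hom_on A f ->
  additive_on (@mmul C) (block n) (fun g => f (to_isom (place (lam n) n%:R g))).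
Proof.
move=> l0 hf g h bg bh; have d0 : lam n != 0 by rewrite gt_eqF.
rewrite placeM// to_isomM ?place_det ?(cyc_cover_det bg) ?(cyc_cover_det bh)//.
by rewrite hf//; exact: gamma_place.
Qed.

End Gamma.

(* For abelianizations that are sums of cyclic groups, as those of the groups below,
   this detects [q]-torsion in the abelianization. *)
Definition nonlifting {G : groupType} (H : set G) (q : nat) : Prop :=
  exists2 chi : G -> 'Z_q, additive_on (fun g h : G => (g * h)%g) H chi &
  forall psi : G -> int, additive_on (fun g h : G => (g * h)%g) H psi ->
    exists2 g, H g & (psi g)%:~R <> chi g.

Lemma isomorphism_inv {G : groupType} (H K : set G) (f : G -> G) : is_subgroup H ->
  set_bij H K f -> (forall x y, H x -> H y -> f (x * y)%g = (f x * f y)%g) ->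
  exists f' : G -> G, [/\ set_bij K H f',
    forall x y, K x -> K y -> f' (x * y)%g = (f' x * f' y)%g &
    forall x, H x -> f' (f x) = x].
Proof.
move=> Hsub [fHK finj fsurj] fM.
have HM x y : H x -> H y -> H (x * y)%g.
  case: Hsub => H1 Hd hx hy; rewrite -[y]invgK; apply: (Hd) => //.
  by rewrite -[y^-1%g]mul1g; apply: Hd.
have /choice[f' hf'] : forall y, exists x, K y -> H x /\ f x = y.
  move=> y; have [Ky|nKy] := pselect (K y); last by exists y.
  by have [x Hx xy] := fsurj y Ky; exists x.
have f'H y : K y -> H (f' y) by case/hf'.
have f'K y : K y -> f (f' y) = y by case/hf'.
have fK x : H x -> f' (f x) = x.
  move=> hx; apply: finj; rewrite ?inE; [exact/f'H/fHK|exact: hx|].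
  by rewrite f'K//; exact: fHK.
exists f'; split => //; first split.
- by move=> y /f'H.
- by move=> x y /set_mem Kx /set_mem Ky e; rewrite -[x]f'K// e f'K.
- by move=> x hx; exists (f x); [exact: fHK|exact: fK].
move=> x y Kx Ky; rewrite -[RHS]fK; last by apply: HM; exact: f'H.
by rewrite fM ?f'K//; exact: f'H.
Qed.

Lemma group_isomorphic_sym {G : groupType} (H K : set G) : is_subgroup H ->
  group_isomorphic H K -> group_isomorphic K H.
Proof.
by move=> Hsub [f [fb fM]]; have [f' [f'b f'M _]] := isomorphism_inv Hsub fb fM; exists f'.
Qed.

Lemma nonlifting_isomorphic {G : groupType} (H K : set G) q : is_subgroup H ->
  group_isomorphic H K -> nonlifting H q -> nonlifting K q.
Proof.
move=> Hsub [f [fb fM]] [chi chiM hchi].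
have [f' [[f'H _ _] f'M fK]] := isomorphism_inv Hsub fb fM; have [fHK _ _] := fb.
exists (chi \o f').
  by move=> x y Kx Ky /=; rewrite f'M// chiM//; exact: f'H.
move=> psi psiM; have [|g hg ne] := hchi (psi \o f).
  by move=> x y hx hy /=; rewrite fM// psiM//; exact: fHK.
by exists (f g); [exact: fHK|rewrite /= fK].
Qed.

(** * Detecting which factors are present *)

Section Distinguish.
Variables (R : realType) (p : nat -> nat) (lam : nat -> R).
Hypotheses (hlam : scaling lam) (pp : forall n, prime (p n)).
Local Notation C := R[i].

(** The commutator in the n-th factor is the witness: the chosen homomorphism takes the value 1 on
    it, every integral one the value 0. *)
Lemma nonlifting_present n : injective p -> 0 < lam n -> nonlifting (gamma p lam) (p n).
Proof.
move=> pinj l0; have [chi chiM chi1] := mod_hom_comm R (pp n).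
pose chin m := if m == n then chi else fun=> 0.
have [|f fM fE] := @gamma_hom R p lam hlam _ chin.
  move=> m _; rewrite /chin; have [->//|_] := eqVneq m n.
  by move=> *; rewrite addr0.
exists f => // psi psiM.
have bc := cyc_cover_comm R (p n).
exists (to_isom (place (lam n) n%:R (kev R comm))); first exact: gamma_place.
have := int_hom_comm (prime_gt0 (pp n)) (hom_on_place l0 psiM) => /= ->.
have := fE [:: (n, kev R comm)]; rewrite [tev _ _]mmulr1 /= => ->//.
by rewrite /chin eqxx chi1 addr0 => /eqP; rewrite eq_sym oner_eq0.
Qed.

(** A homomorphism modulo [q] lifts on each factor by [lift_hom], and the free product assembles the
    lifts. *)
Lemma nonlifting_absent q : prime q -> (forall n, 0 < lam n -> p n <> q) ->
  ~ nonlifting (gamma p lam) q.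
Proof.
move=> pq hq [chi chiM hchi].
have /choice[psi hpsi] : forall n, exists psi : mat2 C -> int, 0 < lam n ->
    additive_on (@mmul C) (@cyc_cover R (p n)) psi /\
    forall g, cyc_cover (p n) g -> (psi g)%:~R = chi (to_isom (place (lam n) n%:R g)).
  move=> n; have [l0|] := ltP 0 (lam n); last by exists (fun=> 0).
  have pnq : p n != q by apply/eqP; exact: hq.
  by have [psi h1 h2] := lift_hom (pp n) pq pnq (hom_on_place l0 chiM); exists psi.
have [n /hpsi[]//|f fM fE] := @gamma_hom R p lam hlam _ psi.
have [_ [w lw ->]] := hchi f fM; apply.
rewrite fE//; elim: w lw => [_|x w IH [l0 bx lw]].
  rewrite /= to_isom1; apply/esym/eqP.
  have := chiM 1%g 1%g (gamma1 _ _) (gamma1 _ _); rewrite mulg1 => /eqP.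
  by rewrite -subr_eq subrr eq_sym.
rewrite /= rmorphD /= IH// to_isomM ?(tev_det lw) ?(sev_det l0 bx)//.
rewrite chiM; [|exact: gamma_place|by exists w].
by have [_ ->] := hpsi _ l0.
Qed.

End Distinguish.

(** * Chabauty limits *)

Lemma near_finite_set (T : Type) (A : set T) (Q : T -> nat -> Prop) : finite_set A ->
  (forall w, A w -> \forall i \near \oo, Q w i) ->
  \forall i \near \oo, forall w, A w -> Q w i.
Proof.
move=> Afin hA.
have /choice[N hN] : forall w, exists n, A w -> forall i, (n <= i)%N -> Q w i.
  move=> w; have [Aw|nAw] := pselect (A w); last by exists 0%N.
  by have [n _ hn] := hA w Aw; exists n => _ i ni; exact: hn.
have /finite_seqP[s sE] := finite_image N Afin.
exists (sumn s) => // i /= si w Aw; apply: hN => //; apply: leq_trans si.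
have : N w \in s by have : (N @` A) (N w) by [exists w]; rewrite sE.
by elim: s {sE} => //= n s IH; rewrite inE => /orP[/eqP ->|/IH h]; lia.
Qed.

Section FiniteWords.
Variable R : realType.
Local Notation C := R[i].

Lemma finite_int (N : nat) : finite_set [set m : int | `|m| <= N%:Z].
Proof.
apply: (@sub_finite_set _ _ ((fun j : nat => j%:Z - N%:Z) @` `I_(N + N).+1)).
  move=> m /= mN; exists (absz (m + N%:Z : int)) => /=; lia.
exact/finite_image/finite_II.
Qed.

Lemma finite_gauss (N : nat) : finite_set [set z : C | gauss z /\ cn z <= N%:R].
Proof.
apply: (@sub_finite_set _ _ [set (m%:~R +i* n%:~R)%C | m in [set m : int | `|m| <= N%:Z]
    & n in [set m : int | `|m| <= N%:Z]]); last exact: (finite_image2 _ (finite_int N) (finite_int N)).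
move=> _ [[m [n ->]] h]; have [/= h1 h2] := ReIm_le (m%:~R +i* n%:~R : C)%C.
by exists m; [|exists n => //]; rewrite /= -(ler_int R) intr_norm; [exact: le_trans h1 h|exact: le_trans h2 h].
Qed.

Definition mbounded (N : nat) (g : mat2 C) :=
  [/\ cn (ma g) <= N%:R, cn (mb g) <= N%:R, cn (mc g) <= N%:R & cn (md g) <= N%:R].

Lemma finite_syllables (N : nat) :
  finite_set [set x : syllable R | [/\ (x.1 < N)%N, mgauss x.2 & mbounded N x.2]].
Proof.
have F := finite_gauss N; set G := [set z | _] in F.
apply: (@sub_finite_set _ _ ((fun t : nat * ((C * C) * (C * C)) =>
   (t.1, Mat2 t.2.1.1 t.2.1.2 t.2.2.1 t.2.2.2)) @` (`I_N `*` ((G `*` G) `*` (G `*` G))))).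
  move=> [n [a b c d]] /= [nN [? ? ? ?] [? ? ? ?]].
  by exists (n, ((a, b), (c, d))) => //=; do ![split].
by apply: finite_image; do ?apply: finite_setX.
Qed.

Lemma finite_words (T : Type) (A : set T) (N : nat) : finite_set A ->
  finite_set [set w : seq T | (size w <= N)%N /\ forall l r x, w = l ++ x :: r -> A x].
Proof.
move=> Af; elim: N => [|N IH].
  apply: (@sub_finite_set _ _ [set [::]]); last exact: finite_set1.
  by move=> [|x w] [].
apply: (@sub_finite_set _ _ ([set [::]] `|` [set x :: w | x in A & w in
    [set w : seq T | (size w <= N)%N /\ forall l r x, w = l ++ x :: r -> A x]])).
  move=> [|x w] [sw hw]; [by left|right].
  exists x; first exact: (hw [::] w).
  by exists w => //; split => // l r y e; apply: (hw (x :: l) r); rewrite e.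
rewrite finite_setU; split; first exact: finite_set1.
exact: finite_image2.
Qed.

End FiniteWords.

Section Limits.
Variables (R : realType) (p : nat -> nat).
Local Notation C := R[i].

Lemma place_cvg (l : nat -> R) (l0 : R) z0 g : l0 != 0 -> l @ \oo --> l0 ->
  mcvg (fun i => place (l i) z0 g) (place l0 z0 g).
Proof.
move=> l00 cl; have c1 := ccvg_real cl.
have c2 : ccvg (fun i => ((l i)%:C%C : C)^-1) (l0%:C%C)^-1.
  have e (x : R) : (x%:C%C : C)^-1 = (x^-1)%:C%C by rewrite fmorphV.
  rewrite e; under eq_fun do rewrite e.
  by apply: ccvg_real; exact: cvgV.
have c3 a : ccvg (fun i => - (a / (l i)%:C%C : C)) (- (a / l0%:C%C)).
  by rewrite -mulNr; under eq_fun do rewrite -mulNr; exact: ccvgM (ccvg_cst _) c2.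
split.
- exact: ccvgD (ccvg_cst _) (ccvgM (ccvg_cst _) c2).
- exact: ccvgD (ccvgD (ccvgM c1 (ccvg_cst _)) (ccvg_cst _)) (c3 _).
- exact: ccvgM (ccvg_cst _) c2.
- exact: ccvgD (ccvg_cst _) (c3 _).
Qed.

Variables (lam : nat -> R) (mu : nat -> nat -> R).
Hypothesis hmu : forall i, scaling (mu i).
Hypothesis cmu : forall n, (fun i => mu i n) @ \oo --> lam n.

Lemma tev_cvg w : legal p lam w -> mcvg (fun i => tev (mu i) w) (tev lam w).
Proof.
elim: w => [_|x w IH [l0 bx /IH h]]; first exact: mcvg_cst.
apply: mcvgM => //; apply: place_cvg; last exact: cmu.
by rewrite gt_eqF.
Qed.

Lemma legal_near w : legal p lam w -> \forall i \near \oo, legal p (mu i) w.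
Proof.
elim: w => [_|x w IH [l0 bx /IH h]]; first exact: nearW.
have h2 : \forall i \near \oo, 0 < mu i x.1 by exact: cvgr_gt (@cmu x.1) _ l0.
by apply: filterS (filterI h2 h) => i [? ?]; split.
Qed.

Lemma mcvg_near (M N : nat -> mat2 C) L : (\forall i \near \oo, M i = N i) ->
  mcvg M L -> mcvg N L.
Proof.
move=> h [[a1 a2] [b1 b2] [c1 c2] [d1 d2]].
have e (f : mat2 C -> R) (l : R) : (fun i => f (M i)) @ \oo --> l -> (fun i => f (N i)) @ \oo --> l.
  by apply: cvg_trans; apply: near_eq_cvg; apply: filterS h => i /= ->.
split; split.
- exact: (e (fun g => complex.Re (ma g)) _ a1).
- exact: (e (fun g => complex.Im (ma g)) _ a2).
- exact: (e (fun g => complex.Re (mb g)) _ b1).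
- exact: (e (fun g => complex.Im (mb g)) _ b2).
- exact: (e (fun g => complex.Re (mc g)) _ c1).
- exact: (e (fun g => complex.Im (mc g)) _ c2).
- exact: (e (fun g => complex.Re (md g)) _ d1).
- exact: (e (fun g => complex.Im (md g)) _ d2).
Qed.

Lemma tev_to_isom_cvg w : legal p lam w -> exists2 psi : nat -> isom R,
  (forall i, gamma p (mu i) (psi i)) /\
  (\forall i \near \oo, psi i = to_isom (tev (mu i) w)) &
  psi @ \oo --> to_isom (tev lam w).
Proof.
move=> lw.
(* At the finitely many [i] where a factor used by [w] is still absent, the identity is the
   approximating element. *)
pose M i := if pselect (legal p (mu i) w) is left _ then tev (mu i) w else mone.
have M1 i : mdet (M i) = 1.
  by rewrite /M; case: pselect => [h|_]; [exact: tev_det h|exact: mdet1].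
have MN : \forall i \near \oo, tev (mu i) w = M i.
  by apply: filterS (legal_near lw) => i li; rewrite /M; case: pselect.
exists (fun i => to_isom (M i)).
  split; last by apply: filterS MN => i ->.
  move=> i; rewrite /M; case: pselect => [h|_]; first by exists w.
  by rewrite to_isom1; exact: gamma1.
apply: to_isom_cvg => //; first exact: tev_det lw.
exact: mcvg_near MN (tev_cvg lw).
Qed.

Lemma legalP (nu : nat -> R) w : legal p nu w <->
  forall l r x, w = l ++ x :: r -> 0 < nu x.1 /\ @cyc_cover R (p x.1) x.2.
Proof.
elim: w => [|y w IH]; first by split=> // _ [|? ?] ? ?.
split=> [[ly by_ lw] [|z l] r x|h].
- by move=> [<- _].
- by move=> [_ e]; move/IH: lw => h; exact: h e.
have [ly by_] := h [::] w y erefl; split => //; apply/IH => l r x e.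
by apply: (h (y :: l) r); rewrite e.
Qed.

Lemma weights_bounded (nu : nat -> R) w : scaling nu -> legal p nu w -> alternates w ->
  2 ^+ size w <= \prod_(y <- w) weight nu y /\
  forall l r x, w = l ++ x :: r -> x.2 <> mone /\ weight nu x <= \prod_(y <- w) weight nu y.
Proof.
move=> hnu; elim: w => [|y w IH]; first by rewrite big_nil; split=> // -[|? ?] ? ?.
move=> [ly by_ lw] [y1 _ aw]; have [h1 h2] := IH lw aw.
have wy := weight_ge2 hnu ly by_ y1; rewrite big_cons exprS.
have p2 : 1 <= 2 ^+ size w :> R by rewrite exprn_ege1// ler1n.
move: h1 h2; set P := \prod_(_ <- _) _ => h1 h2.
split; first by rewrite ler_pM// ?exprn_ge0.
move=> [|z l] r x [yx]; first by rewrite -yx => _; split=> //; nra.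
by move=> e; have [x1 hx] := h2 _ _ _ e; split=> //; nra.
Qed.

(** The index is bounded because the n-th scale is at most 1 / (8 (n + 1)), and the entries because
    |c| dominates them. The bounds do not depend on the scales, so one finite set of syllables
    serves the whole sequence. *)
Lemma syllable_bounded (nu : nat -> R) (x : syllable R) N : scaling nu -> 0 < nu x.1 ->
  @cyc_cover R (p x.1) x.2 -> x.2 <> mone -> weight nu x <= N%:R ->
  [/\ (x.1 < N)%N, mgauss x.2 & mbounded N x.2].
Proof.
move=> hnu l0 bx x1; rewrite /weight ler_pdivrMr ?mulr_gt0// => h.
have [c1 ac dc] := block_bound bx x1; have bc := mb_le (cyc_cover_det bx) c1 ac dc.
have /andP[_ hn] := hnu x.1.
have n1 : 1 <= x.1.+1%:R :> R by rewrite ler1n.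
have {}hn : nu x.1 * (8 * x.1.+1%:R) <= 1.
  by rewrite -ler_pdivlMr ?mulr_gt0 ?ltr0n// mul1r.
have N0 : 0 <= N%:R :> R by exact: ler0n.
have c2 : 2 * cn (mc x.2) * x.1.+1%:R <= N%:R.
  apply: le_trans (_ : N%:R * (nu x.1 * (8 * x.1.+1%:R)) <= _); first by nra.
  by rewrite -[leRHS]mulr1 ler_wpM2l.
have c3 : 2 * cn (mc x.2) <= N%:R.
  by apply: le_trans c2; rewrite ler_peMr// mulr_ge0// cn_ge0.
split; last by split; lra.
  by rewrite -(ltr_nat R); move: c2; rewrite -natr1; nra.
by case: bx => w -> _; exact: kev_gauss.
Qed.

(** Convergence bounds the lower left entries, so alternating words for the [psi i] eventually come
    from one finite set. If [g] were not in the limit group, each of these words would eventually be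
    excluded: its isometries converge elsewhere, or it uses a vanishing factor, whose weights become
    too large. *)
Lemma gamma_limit (psi : nat -> isom R) g :
  (forall i, gamma p (mu i) (psi i)) -> psi @ \oo --> g -> gamma p lam g.
Proof.
move=> hpsi cpsi.
have /choice[W hW] : forall i, exists w,
    [/\ legal p (mu i) w, alternates w & psi i = to_isom (tev (mu i) w)].
  by move=> i; have [w /reduce[w' [lw aw <- _ _]] e] := hpsi i; exists w'.
have [B hB] : exists B, \forall i \near \oo, cn (mc (tev (mu i) (W i))) <= B.
  apply: (@mc_bounded _ _ g); first by move=> i; have [/tev_det] := hW i.
  rewrite (_ : (fun i => _) = psi)//.
  by apply/funext => i; have [_ _ ->] := hW i.
pose N := Num.bound `|B|.
have BN : B <= N%:R by rewrite (le_trans (ler_norm _))// ltW// archi_boundP.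
apply: contrapT => ng.
pose Q w i := ~ [/\ legal p (mu i) w, alternates w,
  forall l r x, w = l ++ x :: r -> weight (mu i) x <= N%:R & psi i = to_isom (tev (mu i) w)].
have := near_finite_set (finite_words N (finite_syllables R N)) (Q := Q).
case=> [w _|M _ hM].
  have [lw|] := pselect (legal p lam w).
    have [psi' [_ e] c'] := tev_to_isom_cvg lw.
    have [x gx] : exists x, g x <> to_isom (tev lam w) x.
      apply: contrapT => h; apply: ng; exists w => //; apply: isomP => x.
      by apply: contrapT => gx; apply: h; exists x.
    have d0 : 0 < mdist (g x) (to_isom (tev lam w) x) / 2.
      by rewrite divr_gt0// mdist_gt0; exact/eqP.
    have /cvg_mdistP/(_ _ d0) h1 := @cvg_isom_eval _ _ _ x cpsi.
    have /cvg_mdistP/(_ _ d0) h2 := @cvg_isom_eval _ _ _ x c'.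
    near=> i => -[_ _ _ ei].
    have k1 : mdist (g x) (psi i x) < mdist (g x) (to_isom (tev lam w) x) / 2 by near: i.
    have k2 : mdist (to_isom (tev lam w) x) (psi' i x) < mdist (g x) (to_isom (tev lam w) x) / 2.
      by near: i.
    have ei' : psi' i = to_isom (tev (mu i) w) by near: i.
    move: k2; rewrite ei' -ei metric_sym => k2.
    by have := metric_triangle (g x) (psi i x) (to_isom (tev lam w) x); lra.
  move=> nl.
  have [l [r [x [e nx]]]] : exists l r x, w = l ++ x :: r /\
      ~ (0 < lam x.1 /\ @cyc_cover R (p x.1) x.2).
    apply: contrapT => h; apply: nl; apply/legalP => l r x e.
    by apply: contrapT => nx; apply: h; exists l, r, x.
  have [bx|nb] := pselect (@cyc_cover R (p x.1) x.2); last first.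
    by near=> i => -[/legalP/(_ _ _ _ e)[_ bx]].
  have [x1|x1] := pselect (x.2 = mone).
    by near=> i => -[lw aw _ _]; have [_ /(_ _ _ _ e)[]] := weights_bounded (hmu i) lw aw.
  (* Below this scale the weight exceeds N, because |c| >= 1. *)
  have l0 : lam x.1 < (4 * N.+1%:R)^-1.
    have [h|h] := leP (lam x.1) 0; last by case: nx.
    by rewrite (le_lt_trans h)// invr_gt0 mulr_gt0 ?ltr0n.
  have : \forall i \near \oo, mu i x.1 < (4 * N.+1%:R)^-1 by exact: cvgr_lt (@cmu x.1) _ l0.
  apply: filterS => i hi -[lw aw hw _].
  have := hw _ _ _ e; have /legalP/(_ _ _ _ e)[m0 _] := lw.
  have [c1 _ _] := block_bound bx x1.
  rewrite /weight ler_pdivrMr ?mulr_gt0//.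
  move: hi; rewrite -[ltRHS]mul1r ltr_pdivlMr ?mulr_gt0 ?ltr0n// -natr1.
  by have : 0 <= N%:R :> R by [exact: ler0n]; nra.
have [M' _ hM'] := hB; pose i := maxn M M'.
have iM : (M <= i)%N by exact: leq_maxl.
have iB : cn (mc (tev (mu i) (W i))) <= B by apply: hM'; exact: leq_maxr.
have [lw aw e] := hW i; have [s1 s2] := weights_bounded (hmu i) lw aw.
have wB : \prod_(y <- W i) weight (mu i) y <= N%:R \/ W i = [::].
  case: (W i) lw aw iB => [|x w] lw aw iB; [by right|left].
  by have [_ h _] := growth (hmu i) lw aw; apply: le_trans h (le_trans iB BN).
apply: (hM i iM (W i)).
  split.
    case: wB => [wB|->//]; rewrite -(ler_nat R); apply: le_trans (le_trans s1 wB).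
    by rewrite -natrX ler_nat ltnW// ltn_expl.
  move=> l r x wE; have [x1 hx] := s2 _ _ _ wE; have /legalP/(_ _ _ _ wE)[l0 bx] := lw.
  apply: (syllable_bounded (hmu i) l0 bx x1); apply: (le_trans hx).
  by case: wB => // w0; move: wE; rewrite w0; case: (l).
split => // l r x wE; have [x1 hx] := s2 _ _ _ wE; apply: (le_trans hx).
by case: wB => // w0; move: wE; rewrite w0; case: (l).
Unshelve. all: by end_near. Qed.

End Limits.

(** * The path *)

Section Path.
Variable R : realType.
Implicit Types (s t : R) (lam : nat -> R).

Lemma gamma_chabauty p lam (mu : nat -> nat -> R) (hlam : scaling lam)
    (hmu : forall i, scaling (mu i)) : (forall n, (fun i => mu i n) @ \oo --> lam n) ->
  chabauty_cvg (fun i => Gamma p (hmu i)) (Gamma p hlam).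
Proof.
move=> cmu; split=> [psi k g hpsi kinc|_ [w lw ->]]; last first.
  by have [psi [hpsi _] c] := tev_to_isom_cvg cmu lw; exists psi.
have kge i : (i <= k i)%N.
  elim: i => // i IH; apply: leq_ltn_trans IH _.
  by rewrite ltnNge -leEnat kinc ltnn.
have ck : k @ \oo --> \oo.
  by move=> A [N _ hA]; exists N => // i /= Ni; apply: hA => /=; exact: leq_trans (kge i).
apply: (@gamma_limit R p lam (fun i => mu (k i)) (fun i => hmu (k i)) _ (psi \o k) g) => // [n|i].
  exact: cvg_comp ck (@cmu n).
exact: hpsi.
Qed.

Fixpoint primeseq n : nat := if n is m.+1 then s2val (prime_above (primeseq m)) else 2.

Lemma primeseq_prime n : prime (primeseq n).
Proof. by case: n => //= n; case: prime_above. Qed.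

Lemma primeseq_inj : injective primeseq.
Proof.
have h : {homo primeseq : i j / (i < j)%N >-> (i < j)%N}.
  by apply: homo_ltn => [? ? ?|i]; [exact: ltn_trans|rewrite /=; case: prime_above].
by move=> i j e; case: (ltngtP i j) => // /h; rewrite e ltnn.
Qed.

(* The [n]-th factor is present exactly when [t] exceeds the [n]-th rational number. *)
Definition factor_scale t n : R :=
  Num.min (Num.max 0 (t - ratr (odflt 0 (unpickle n)))) (8 * n.+1%:R)^-1.

Lemma factor_scale_bounds t : scaling (factor_scale t).
Proof. by move=> n; rewrite le_min le_max lexx invr_ge0 mulr_ge0//= ge_min lexx orbT. Qed.

Lemma factor_scale_gt0 t (q : rat) : (0 < factor_scale t (pickle q)) = (ratr q < t).
Proof. by rewrite lt_min lt_max ltxx pickleK subr_gt0 invr_gt0 mulr_gt0 ?ltr0n// andbT. Qed.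

Lemma factor_scale_continuous n : continuous (fun t => factor_scale t n).
Proof.
move=> t; pose q : R := ratr (odflt 0 (unpickle n)).
apply: (@continuous_min R R (fun s => Num.max 0 (s - q)) (fun=> _)); last exact: cvg_cst.
apply: (@continuous_max R R (fun=> 0) (fun s => s - q)); first exact: cvg_cst.
by apply: cvgB; [exact: cvg_id|exact: cvg_cst].
Qed.

Definition gamma_path t : D3 R := Gamma primeseq (factor_scale_bounds t).

(** Open sets of [D3] are tested on sequences only, which is enough on a metric domain: a failure at
    [t] yields a sequence tending to [t] outside [U]. *)
Lemma gamma_path_continuous : continuous gamma_path.
Proof.
move=> t A; rewrite nbhsE => -[U [oU Ut] UA].
have {}UA : gamma_path @^-1` U `<=` gamma_path @^-1` A by move=> x /=; exact: UA.
apply: (filterS UA); apply: contrapT => nU.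
have /choice[u hu] : forall i, exists s, `|t - s| < i.+1%:R^-1 /\ ~ U (gamma_path s).
  move=> i; apply: contrapT => h; apply: nU; apply/nbhs_ballP.
  exists i.+1%:R^-1 => /=; first by rewrite invr_gt0 ltr0n.
  by move=> s ts; apply: contrapT => nUs; apply: h; exists s.
have ut : u @ \oo --> t.
  apply/cvgrPdist_lt => e e0; apply: filterS (near_infty_natSinv_lt (PosNum e0)) => i.
  by apply: lt_trans; have [] := hu i.
have : chabauty_cvg (gamma_path \o u) (gamma_path t).
  apply: gamma_chabauty => n.
  exact: (cvg_comp u (fun s => factor_scale s n) ut (@factor_scale_continuous n t)).
by move=> /oU/(_ Ut)[N _ /(_ N (leqnn N))]; have [] := hu N.
Qed.

(** A rational strictly between [s] and [t] indexes a factor present at [t] and absent at [s], and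
    its prime belongs to no other factor. *)
Lemma gamma_path_not_isomorphic s t : s < t -> ~ group_isomorphic (gamma_path t) (gamma_path s).
Proof.
move=> /rat_in_itvoo[q]; rewrite in_itv => /andP[sq qt] iso.
have : nonlifting (gamma_path s) (primeseq (pickle q)).
  apply: (nonlifting_isomorphic (D3_subgroup (gamma_path t)) iso).
  apply: nonlifting_present primeseq_inj _ => //.
  - exact: factor_scale_bounds.
  - exact: primeseq_prime.
  - by rewrite factor_scale_gt0.
apply: nonlifting_absent => //.
- exact: factor_scale_bounds.
- exact: primeseq_prime.
- exact: primeseq_prime.
- move=> n n0 /primeseq_inj e; move: n0; rewrite e factor_scale_gt0 => /lt_trans/(_ sq).
  by rewrite ltxx.
Qed.

End Path.

Theorem theorem1 (R : realType) :
  exists Phi : R -> D3 R,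
    {within `[0, 1], continuous Phi} /\
    forall s t : R, s \in `[0, 1] -> t \in `[0, 1] ->
      (group_isomorphic (Phi t) (Phi s) <-> t = s).
Proof.
exists (@gamma_path R); split; first exact/continuous_subspaceT/gamma_path_continuous.
move=> s t _ _; split=> [iso|->].
  case: (ltgtP s t) => // st; first by case: (gamma_path_not_isomorphic st).
  case: (gamma_path_not_isomorphic st).
  exact: group_isomorphic_sym (D3_subgroup _) iso.
by exists id; split=> //; split=> // x Hx; exists x.
Qed.
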